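(* Let $m,n\geq1$ be integers with $d=m+n\geq3$ and let $\Theta$ be a real $n\times m$ matrix. For $m=1$ we have \[ \mathfrak a_2\geq(1-\mathfrak a_1)^{-1}-\frac{n-2}{n-1}. \] For $m\geq2$ we have \[ \mathfrak a_2\geq\frac{n-1}{-n-(d-2)(1-\mathfrak a_1)^{-1}}\ \text{ if }\ \mathfrak a_1\leq1,\qquad \mathfrak a_2\geq\frac{m-1}{n+(d-2)(\mathfrak a_1-1)^{-1}}\ \text{ if }\ \mathfrak a_1\geq1. \]
   Context: Let $\vec e_1,\ldots,\vec e_d$ be the standard basis of $\mathbb R^d$ and let $\boldsymbol\ell_1,\ldots,\boldsymbol\ell_d$ be the columns of the $d\times d$ matrix $\begin{pmatrix}E_m&-{}^t\Theta\\ \Theta&E_n\end{pmatrix}$, where $E_k$ denotes the $k\times k$ identity matrix. For each $q$, $\wedge^q(\mathbb R^d)$ is regarded as a Euclidean space with orthonormal basis $\vec e_{i_1}\wedge\cdots\wedge\vec e_{i_q}$, $1\leq i_1<\cdots<i_q\leq d$, and $|\cdot|$ denotes the sup-norm of coordinates in this basis ($\wedge^0=\mathbb R$). $\wedge^p(\mathbb Z^d)$ denotes the elements with integer coordinates. For $\sigma=\{i_1<\cdots<i_k\}$ set $\vec L_\sigma=\boldsymbol\ell_{i_1}\wedge\cdots\wedge\boldsymbol\ell_{i_k}$, $\vec L_\varnothing=1$; $\mathcal J_k$ is the set of $k$-element subsets of $\{1,\ldots,m\}$; $k_0=\max(0,m-p)$. The $p$-th uniform Diophantine exponent of the second type $\mathfrak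 a_p$ is the supremum of real $\gamma$ such that for every sufficiently large $t$ the system $\max_{\sigma\in\mathcal J_k}|\vec L_\sigma\wedge\vec Z|\leq t^{1-(k-k_0)(1+\gamma)}$, $k=0,\ldots,m$, has a nonzero solution $\vec Z\in\wedge^p(\mathbb Z^d)$. *)

(* Defs.v *)
From mathcomp Require Import all_boot all_order all_algebra.
From mathcomp Require Import all_classical all_reals all_analysis.

Set Implicit Arguments.
Unset Strict Implicit.
Unset Printing Implicit Defensive.

Import Order.TTheory GRing.Theory Num.Theory.
Import numFieldNormedType.Exports.

Local Open Scope ring_scope.

(* The exterior algebra of R^d is encoded by coordinates: the value of
   w : {ffun {set 'I_d} -> R} at S = {i_1 < ... < i_q} is the coefficient of w
   on e_{i_1} /\ ... /\ e_{i_q}.  The q-th exterior power consists of those w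
   that vanish outside the sets of cardinality q (see ext_homog). *)

Definition ext_basis (R : realType) (d : nat) (A : {set 'I_d}) :
    {ffun {set 'I_d} -> R} :=
  [ffun S => (S == A)%:R].

Definition ext_vec (R : realType) (d : nat) (v : 'cV[R]_d) :
    {ffun {set 'I_d} -> R} :=
  \sum_(i < d) v i 0 *: ext_basis R [set i].

(* For disjoint A and B, the number of transpositions needed to sort the
   increasing enumeration of A followed by that of B. *)
Definition inversions (d : nat) (A B : {set 'I_d}) : nat :=
  #|[set ab in finset.setX A B | (ab.2 < ab.1)%N]|.

Definition wedge (R : realType) (d : nat) (u v : {ffun {set 'I_d} -> R}) :
    {ffun {set 'I_d} -> R} :=
  [ffun S : {set 'I_d} => \sum_(A : {set 'I_d} | A \subset S)
     (-1) ^+ inversions A (S :\: A) * u A * v (S :\: A)].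

(* The wedge product of the columns of A with index in sigma, in increasing
   order; it is 1 when sigma is empty. *)
Definition wedge_cols (R : realType) (d : nat) (A : 'M[R]_d)
    (sigma : {set 'I_d}) : {ffun {set 'I_d} -> R} :=
  \big[@wedge R d/ext_basis R finset.set0]_(i <- enum sigma) ext_vec (col i A).

Definition ext_homog (R : realType) (d : nat) (q : nat)
    (w : {ffun {set 'I_d} -> R}) : Prop :=
  forall S : {set 'I_d}, #|S| != q -> w S = 0.

Definition ext_integral (R : realType) (d : nat)
    (w : {ffun {set 'I_d} -> R}) : Prop :=
  forall S : {set 'I_d}, w S \is a Num.int.

Definition ext_norm (R : realType) (d : nat)
    (w : {ffun {set 'I_d} -> R}) : R :=
  \big[Num.max/0]_(S : {set 'I_d}) `|w S|.

Definition ell (R : realType) (m n : nat) (Theta : 'M[R]_(n, m)) :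
    'M[R]_(m + n) :=
  block_mx 1%:M (- Theta^T) Theta 1%:M.

(* The k-element sets of indices among the first m of the m + n indices. *)
Definition J (m n k : nat) : {set {set 'I_(m + n)}} :=
  [set sigma : {set 'I_(m + n)} |
    (sigma \subset [set lshift n i | i : 'I_m]) && (#|sigma| == k)].

(* The truncated difference (m - p)%N is k_0 = max(0, m - p). *)
Definition uniform_solvable (R : realType) (m n : nat) (Theta : 'M[R]_(n, m))
    (p : nat) (gamma : R) : Prop :=
  \forall t \near +oo%R, exists Z : {ffun {set 'I_(m + n)} -> R},
    [/\ ext_homog p Z, ext_integral Z, Z != 0 &
        forall k : nat, (k <= m)%N ->
          \big[Num.max/0]_(sigma in J m n k)
             ext_norm (wedge (wedge_cols (ell Theta) sigma) Z)
          <= t `^ (1 - (k%:R - (m - p)%N%:R) * (1 + gamma))].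

Definition uniform_exponent (R : realType) (m n : nat) (Theta : 'M[R]_(n, m))
    (p : nat) : \bar R :=
  ereal_sup [set gamma%:E | gamma in [set gamma : R |
                                       uniform_solvable Theta p gamma]]%classic.

(* Unlike the library inverse on \bar R, which maps -oo to -oo, both infinities
   are mapped to 0; the inverse of 0 is +oo in both cases. *)
Definition einv (R : realType) (x : \bar R) : \bar R :=
  if x is r%:E then (if r == 0 then +oo%E else (r^-1)%:E) else 0%E.

Lemma wedge_basis (R : realType) (d : nat) (A B : {set 'I_d}) :
  wedge (ext_basis R A) (ext_basis R B) =
  if [disjoint A & B] then (-1) ^+ inversions A B *: ext_basis R (A :|: B)
  else 0.
Proof.
apply/ffunP => S; rewrite ffunE.
have E (C : {set 'I_d}) : C \subset S ->
    ext_basis R A C * ext_basis R B (S :\: C) = ((C == A) && (S :\: A == B))%:R.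
  by move=> _; rewrite !ffunE; case: eqP => [->|_]; rewrite /= ?mul1r ?mul0r.
under eq_bigr => C CS do rewrite -mulrA (E C CS).
have [AS|nAS] := boolP (A \subset S).
  rewrite (bigD1 A) //= eqxx /= big1 ?addr0; last first.
    by move=> C /andP[_ /negPf ->]; rewrite mulr0.
  case: eqP => [<-|nB].
    have -> : [disjoint A & S :\: A].
      by rewrite -setI_eq0; apply/eqP/setP => x; rewrite !inE; case: (x \in A).
    rewrite ffunE ffunE mulr1.
    have -> : A :|: S :\: A = S.
      apply/setP => x; rewrite !inE; have := fintype.subsetP AS x.
      by case: (x \in A) => //= ->.
    by rewrite eqxx /GRing.scale /= mulr1.
  rewrite mulr0; case: ifP => dAB; rewrite ?ffunE //.
  case: eqP => [SE|_]; last by rewrite scaler0.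
  case: nB; rewrite SE; apply/setP => x; rewrite !inE.
  have := disjointFr dAB (x := x).
  by case: (x \in A) => //= ->.
rewrite big1; last first.
  move=> C CS; case: eqP => [CA|_]; last by rewrite mulr0.
  by rewrite CA (negPf nAS) in CS.
case: ifP => _; rewrite ?ffunE //; case: eqP => [SE|_]; last by rewrite scaler0.
by rewrite SE finset.subsetUl in nAS.
Qed.

Lemma ext_vec_basis (R : realType) (d : nat) (i : 'I_d) :
  ext_vec (col i (1%:M : 'M[R]_d)) = ext_basis R [set i].
Proof.
rewrite /ext_vec (bigD1 i) //= !mxE eqxx scale1r big1 ?addr0 //.
by move=> j /negPf ji; rewrite !mxE ji scale0r.
Qed.

Lemma wedge_cols_basis (R : realType) (d : nat) (sigma : {set 'I_d}) :
  wedge_cols (1%:M : 'M[R]_d) sigma = ext_basis R sigma.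
Proof.
rewrite /wedge_cols -[in RHS](finset.set_enum sigma).
have : sorted (fun i j : 'I_d => (i < j)%N) (enum sigma).
  rewrite /enum_mem -enumT; apply: sorted_filter.
    by move=> y x z; apply: ltn_trans.
  by rewrite -(sorted_map (f := @nat_of_ord d) (e' := ltn)) val_enum_ord iota_ltn_sorted.
elim: (enum sigma) => [|i s IHs] ss.
  by rewrite big_nil; congr ext_basis; apply/setP => x; rewrite !inE.
rewrite big_cons IHs; last exact: path_sorted ss.
have lt_i j : j \in s -> (i < j)%N.
  move=> js; move: ss; rewrite /= path_sortedE; last first.
    by move=> y x z; apply: ltn_trans.
  by move=> /andP[/allP/(_ j js)].
rewrite ext_vec_basis wedge_basis ifT; last first.
  rewrite disjoints1 inE; apply/negP => /lt_i; by rewrite ltnn.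
have -> : inversions [set i] [set x in s] = 0%N.
  apply/eqP; rewrite cards_eq0; apply/eqP/setP => -[a b]; rewrite !inE /=.
  apply/negP => /andP[/andP[/eqP-> /lt_i ib]] bi.
  by have := ltn_trans ib bi; rewrite ltnn.
by rewrite expr0 scale1r; congr ext_basis; apply/setP => x; rewrite !inE.
Qed.

(* Main.v *)
Require Import Defs.
From mathcomp Require Import all_boot all_order all_algebra.
From mathcomp Require Import all_classical all_reals all_analysis.
From mathcomp Require Import ring lra zify.

(** Write z = (x, y) for an integer vector and beta = m/n.  Multiplying x by e^-s
    and y - Theta x by e^(beta s) gives a flow of unimodular lattices, and a_1
    measures the linear rate psi = (a_1 - beta)/(1 + a_1) at which their shortest
    vectors decay.  Fix s, let z be primitive with norm at most e^(-psi s) at time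
    s, say norm e^-a, and look for a vector w not parallel to z with the product
    of the two norms small.  If a is large, Minkowski-type counting gives w.
    Otherwise z expands when the flow is run forward (if its norm is attained on
    y - Theta x) or backward (if it is attained on x), so that at a suitable time,
    not too far from s, the short vector provided by a_1 is no multiple of z; this
    is w.  The bivector of z and w then solves the system defining a_2, because
    wedging with L_sigma kills the coordinates of sigma.  The two regimes a_1 <= 1
    and a_1 >= 1 correspond to the forward and backward case being the worst. *)

Set Implicit Arguments.
Unset Strict Implicit.
Unset Printing Implicit Defensive.

Import Order.TTheory GRing.Theory Num.Theory.
Import numFieldNormedType.Exports.

Local Open Scope ring_scope.

(** * Exterior algebra in coordinates, and the maps that matrices induce on it *)

Section Exterior.
Variables (R : realType) (d : nat).
Implicit Types (u v w : {ffun {set 'I_d} -> R}) (M N : 'M[R]_d).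

Lemma wedgeDl u v w : wedge (u + v) w = wedge u w + wedge v w.
Proof.
apply/ffunP => S; rewrite !ffunE -big_split; apply: eq_bigr => A _.
by rewrite !ffunE mulrDr mulrDl.
Qed.

Lemma wedgeDr u v w : wedge u (v + w) = wedge u v + wedge u w.
Proof.
apply/ffunP => S; rewrite !ffunE -big_split; apply: eq_bigr => A _.
by rewrite !ffunE mulrDr.
Qed.

Lemma wedgeZl a u v : wedge (a *: u) v = a *: wedge u v.
Proof.
apply/ffunP => S; rewrite !ffunE scaler_sumr; apply: eq_bigr => A _.
by rewrite !ffunE /GRing.scale /=; ring.
Qed.

Lemma wedgeZr a u v : wedge u (a *: v) = a *: wedge u v.
Proof.
apply/ffunP => S; rewrite !ffunE scaler_sumr; apply: eq_bigr => A _.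
by rewrite !ffunE /GRing.scale /=; ring.
Qed.

Lemma wedge0l v : wedge 0 v = 0.
Proof. by have := wedgeZl 0 0 v; rewrite !scale0r. Qed.

Lemma wedge0r u : wedge u 0 = 0.
Proof. by have := wedgeZr 0 u 0; rewrite !scale0r. Qed.

Lemma wedge_suml (I : finType) (P : pred I) F v :
  wedge (\sum_(i | P i) F i) v = \sum_(i | P i) wedge (F i) v.
Proof.
by apply: (big_morph (fun u => wedge u v)) => [u w|]; rewrite ?wedgeDl ?wedge0l.
Qed.

Lemma wedge_sumr (I : finType) (P : pred I) F v :
  wedge v (\sum_(i | P i) F i) = \sum_(i | P i) wedge v (F i).
Proof.
by apply: (big_morph (fun u => wedge v u)) => [u w|]; rewrite ?wedgeDr ?wedge0r.
Qed.

Lemma ext_basis_sum w : w = \sum_(A : {set 'I_d}) w A *: ext_basis R A.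
Proof.
apply/ffunP => S; rewrite sum_ffunE (bigD1 S) //= !ffunE eqxx big1 ?addr0.
  by rewrite /GRing.scale /= mulr1.
by move=> A /negPf AS; rewrite !ffunE eq_sym AS scaler0.
Qed.

Lemma inversionsUr (A B C : {set 'I_d}) : [disjoint B & C] ->
  inversions A (B :|: C) = (inversions A B + inversions A C)%N.
Proof.
move=> dBC; rewrite /inversions -cardsUI [X in (_ + X)%N](_ : _ = 0%N).
  rewrite addn0; apply: eq_card => -[a b]; rewrite !inE /=.
  by case: (a \in A); case: (b \in B); case: (b \in C); case: (b < a)%N.
apply/eqP; rewrite cards_eq0; apply/eqP/setP => -[a b]; rewrite !inE /=.
have := disjointFr dBC (x := b); case: (b \in B); last by rewrite !andbF.
by move=> ->; rewrite ?andbF.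
Qed.

Lemma inversionsUl (A B C : {set 'I_d}) : [disjoint A & B] ->
  inversions (A :|: B) C = (inversions A C + inversions B C)%N.
Proof.
move=> dAB; rewrite /inversions -cardsUI [X in (_ + X)%N](_ : _ = 0%N).
  rewrite addn0; apply: eq_card => -[a b]; rewrite !inE /=.
  by case: (a \in A); case: (a \in B); case: (b \in C); case: (b < a)%N.
apply/eqP; rewrite cards_eq0; apply/eqP/setP => -[a b]; rewrite !inE /=.
have := disjointFr dAB (x := a); case: (a \in A) => //.
by move=> ->; rewrite ?andbF.
Qed.

(** By multilinearity it suffices to treat basis elements. For pairwise disjoint index sets both
    sides carry the sign exponent [inversions A B + inversions A C + inversions B C]; otherwise both
    vanish. *)
Lemma wedgeA u v w : wedge (wedge u v) w = wedge u (wedge v w).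
Proof.
rewrite (ext_basis_sum u) !wedge_suml; apply: eq_bigr => A _.
rewrite !wedgeZl; congr (_ *: _).
rewrite (ext_basis_sum v) wedge_sumr !wedge_suml wedge_sumr.
apply: eq_bigr => B _; rewrite wedgeZr !wedgeZl wedgeZr; congr (_ *: _).
rewrite (ext_basis_sum w) !wedge_sumr; apply: eq_bigr => C _.
rewrite !wedgeZr; congr (_ *: _).
rewrite !wedge_basis.
have dUr : [disjoint A & B :|: C] = [disjoint A & B] && [disjoint A & C].
  by rewrite -!setI_eq0 finset.setIUr finset.setU_eq0.
have dUl : [disjoint A :|: B & C] = [disjoint A & C] && [disjoint B & C].
  by rewrite -!setI_eq0 finset.setIUl finset.setU_eq0.
have [AB|nAB] := boolP [disjoint A & B]; last first.
  rewrite wedge0l; case: ifP => BC; rewrite ?wedge0r // wedgeZr wedge_basis dUr.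
  by rewrite (negPf nAB) scaler0.
rewrite wedgeZl wedge_basis dUl.
have [BC|nBC] := boolP [disjoint B & C]; last first.
  by rewrite andbF scaler0 wedge0r.
rewrite wedgeZr wedge_basis dUr AB andbT /=.
case: ifP => AC; last by rewrite !scaler0.
rewrite !scalerA -!exprD finset.setUA; congr (_ ^+ _ *: _).
by rewrite inversionsUl // inversionsUr //; lia.
Qed.

Lemma wedge1l u : wedge (ext_basis R finset.set0) u = u.
Proof.
rewrite [in LHS](ext_basis_sum u) wedge_sumr [in RHS](ext_basis_sum u).
apply: eq_bigr => A _; rewrite wedgeZr wedge_basis finset.disjoints_subset finset.sub0set.
rewrite finset.set0U; congr (_ *: _); rewrite /inversions.
rewrite (_ : [set _ in _ | _] = finset.set0) ?cards0 ?expr0 ?scale1r //.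
by apply/setP => -[a b]; rewrite !inE.
Qed.

Lemma wedge1r u : wedge u (ext_basis R finset.set0) = u.
Proof.
rewrite [in LHS](ext_basis_sum u) wedge_suml [in RHS](ext_basis_sum u).
apply: eq_bigr => A _; rewrite wedgeZl wedge_basis disjoint_sym finset.disjoints_subset.
rewrite finset.sub0set finset.setU0; congr (_ *: _); rewrite /inversions.
rewrite (_ : [set _ in _ | _] = finset.set0) ?cards0 ?expr0 ?scale1r //.
by apply/setP => -[a b]; rewrite !inE !andbF.
Qed.

Lemma inversions11 (i j : 'I_d) :
  inversions [set i] [set j] = (j < i)%N :> nat.
Proof.
rewrite /inversions; have [ji|ji] := boolP (j < i)%N.
  rewrite (_ : [set _ in _ | _] = [set (i, j)]) ?cards1 //.
  apply/setP => -[x y]; rewrite !inE /= xpair_eqE.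
  by case: eqP => [->|] //; case: eqP => [->|].
rewrite (_ : [set _ in _ | _] = finset.set0) ?cards0 //.
apply/setP => -[x y]; rewrite !inE /=.
by case: eqP => [->|] //; case: eqP => [->|] //=; rewrite (negPf ji).
Qed.

Lemma wedge_basis1C (i j : 'I_d) :
  wedge (ext_basis R [set i]) (ext_basis R [set j]) =
  - wedge (ext_basis R [set j]) (ext_basis R [set i]).
Proof.
rewrite !wedge_basis !disjoints1 !inE [j == i]eq_sym.
case: eqVneq => [->|nij]; rewrite /= ?oppr0 //.
rewrite finset.setUC -scaleNr; congr (_ *: _).
rewrite !inversions11; have := nij; rewrite -val_eqE neq_ltn.
by case: ltngtP => //= _ _; rewrite ?expr0 ?expr1 ?opprK.
Qed.

Lemma wedge_vecC (a b : 'cV[R]_d) :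
  wedge (ext_vec a) (ext_vec b) = - wedge (ext_vec b) (ext_vec a).
Proof.
rewrite /ext_vec !wedge_suml.
under eq_bigr do rewrite wedgeZl wedge_sumr scaler_sumr.
rewrite exchange_big -sumrN; apply: eq_bigr => i _.
rewrite wedgeZl wedge_sumr scaler_sumr -sumrN; apply: eq_bigr => j _.
rewrite !wedgeZr !scalerA mulrC wedge_basis1C scalerN; congr (- _).
Qed.

Lemma wedge_vecv (a : 'cV[R]_d) : wedge (ext_vec a) (ext_vec a) = 0.
Proof.
apply/eqP; have /eqP := wedge_vecC a a; rewrite -subr_eq0 opprK -mulr2n.
rewrite -scaler_nat scaler_eq0 pnatr_eq0 /=; exact.
Qed.

(** Lists instead of sets allow induction, and allow an index to be put in front before it is sorted
    into place. *)
Definition wedge_seq M (s : seq 'I_d) :=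
  \big[@wedge R d/ext_basis R finset.set0]_(i <- s) ext_vec (col i M).

Lemma wedge_seq_cons M i s :
  wedge_seq M (i :: s) = wedge (ext_vec (col i M)) (wedge_seq M s).
Proof. by rewrite /wedge_seq big_cons. Qed.

Let ordlt := fun i j : 'I_d => (i < j)%N.

Let ordlt_trans : transitive ordlt.
Proof. by move=> y x z; apply: ltn_trans. Qed.

Let sorted_enum (A : {set 'I_d}) : sorted ordlt (enum A).
Proof.
rewrite /enum_mem -enumT; apply: sorted_filter => //.
by rewrite -(sorted_map (f := @nat_of_ord d) (e' := ltn)) val_enum_ord
   iota_ltn_sorted.
Qed.

Lemma wedge_seq_sorted M s : sorted ordlt s ->
  wedge_seq M s = wedge_cols M [set i in s].
Proof.
move=> ss; rewrite /wedge_cols -/(wedge_seq _ _); congr wedge_seq.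
apply: (irr_sorted_eq (leT := ordlt)) => //.
- by move=> x; rewrite /ordlt ltnn.
- by move=> x; rewrite mem_enum inE.
Qed.

(* That c and s' do not depend on M lets the sign be read off from M = 1. *)
Lemma wedge_seq_insert i s : sorted ordlt s -> exists (c : R) s',
  [/\ sorted ordlt s', {subset s' <= i :: s} & forall M,
  wedge (ext_vec (col i M)) (wedge_seq M s) = c *: wedge_seq M s'].
Proof.
elim: s => [|j s IHs] /= ss.
  exists 1, [:: i]; split => // M; by rewrite -wedge_seq_cons scale1r.
have [ij|ji|/val_inj ij] := ltngtP i j.
- exists 1, [:: i, j & s]; split => [|//|M]; first by apply/andP.
  by rewrite -wedge_seq_cons scale1r.
- have [c [s' [ss' s's E]]] := IHs (path_sorted ss).
  exists (- c), (j :: s'); split=> [||M].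
  + rewrite /= path_sortedE // ss' andbT; apply/allP => x /s's.
    rewrite inE => /orP[/eqP->//|].
    by move: ss; rewrite path_sortedE // => /andP[/allP + _]; apply.
  + move=> x; rewrite !inE => /orP[->|/s's]; first by rewrite orbT.
    by rewrite inE => /orP[->//|->]; rewrite !orbT.
  + rewrite !wedge_seq_cons -wedgeA wedge_vecC -scaleN1r wedgeZl wedgeA E.
    by rewrite wedgeZr scalerA mulN1r.
- exists 0, [::]; split=> // M.
  by rewrite wedge_seq_cons -wedgeA ij wedge_vecv wedge0l scale0r.
Qed.

(** The endomorphism of the exterior algebra induced by [M], given by its values on the basis. *)
Definition ext_map M w := \sum_(A : {set 'I_d}) w A *: wedge_cols M A.

Lemma ext_mapD M u v : ext_map M (u + v) = ext_map M u + ext_map M v.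
Proof.
by rewrite -big_split; apply: eq_bigr => A _; rewrite ffunE scalerDl.
Qed.

Lemma ext_mapZ M a u : ext_map M (a *: u) = a *: ext_map M u.
Proof.
by rewrite scaler_sumr; apply: eq_bigr => A _; rewrite ffunE scalerA.
Qed.

Lemma ext_map_sum M (I : finType) (F : I -> {ffun {set 'I_d} -> R}) :
  ext_map M (\sum_i F i) = \sum_i ext_map M (F i).
Proof.
apply: big_morph => [u v|]; first exact: ext_mapD.
by rewrite -(scale0r (0 : {ffun {set 'I_d} -> R})) ext_mapZ !scale0r.
Qed.

Lemma ext_map_basis M A : ext_map M (ext_basis R A) = wedge_cols M A.
Proof.
rewrite /ext_map (bigD1 A) //= ffunE eqxx scale1r big1 ?addr0 //.
by move=> B /negPf AB; rewrite ffunE AB scale0r.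
Qed.

(** By linearity [a] and [u] may be taken from the bases. Basis elements are column wedges of the
    identity matrix, so [wedge_seq_insert] rewrites both sides with the same coefficient and the
    same sorted list, once for the identity and once for [M]. *)
Lemma ext_map_wedge_vec M (a : 'cV[R]_d) u :
  ext_map M (wedge (ext_vec a) u) = wedge (ext_vec (M *m a)) (ext_map M u).
Proof.
have -> : ext_vec (M *m a) = \sum_i a i 0 *: ext_vec (col i M).
  rewrite /ext_vec; under [RHS]eq_bigr do rewrite scaler_sumr.
  rewrite exchange_big; apply: eq_bigr => j _ /=.
  rewrite mxE scaler_suml; apply: eq_bigr => i _.
  by rewrite mxE scalerA mulrC.
rewrite [in LHS](ext_basis_sum u) wedge_sumr ext_map_sum {2}/ext_map wedge_sumr.
apply: eq_bigr => A _; rewrite !wedgeZr ext_mapZ; congr (_ *: _).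
rewrite {1}/ext_vec !wedge_suml ext_map_sum; apply: eq_bigr => i _.
rewrite !wedgeZl ext_mapZ; congr (_ *: _).
have sA := sorted_enum A.
have [c [s [ss _ E]]] := wedge_seq_insert i sA.
rewrite -ext_vec_basis -wedge_cols_basis !E ext_mapZ; congr (_ *: _).
by rewrite !wedge_seq_sorted // wedge_cols_basis ext_map_basis.
Qed.

Lemma ext_map_wedge_cols M N A w :
  ext_map M (wedge (wedge_cols N A) w)
  = wedge (wedge_cols (M *m N) A) (ext_map M w).
Proof.
rewrite /wedge_cols; elim: (enum A) => [|i s IHs]; first by rewrite !big_nil !wedge1l.
rewrite !big_cons !wedgeA ext_map_wedge_vec IHs; congr (wedge (ext_vec _) _).
by apply/colP => k; rewrite !mxE; apply: eq_bigr => l _; rewrite mxE.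
Qed.

Lemma ext_map_vec M (a : 'cV[R]_d) : ext_map M (ext_vec a) = ext_vec (M *m a).
Proof.
rewrite -[in LHS](wedge1r (ext_vec a)) ext_map_wedge_vec ext_map_basis.
by rewrite /wedge_cols enum_set0 big_nil wedge1r.
Qed.

Lemma ext_norm_ge w S : `|w S| <= ext_norm w.
Proof. exact: le_bigmax. Qed.

Lemma ext_norm_le w B : 0 <= B -> (forall S, `|w S| <= B) -> ext_norm w <= B.
Proof. by move=> B0 H; apply: bigmax_le. Qed.

Lemma ext_norm_ge0 w : 0 <= ext_norm w.
Proof. by apply: le_trans (ext_norm_ge w finset.set0). Qed.

Lemma ext_map_bounded M : exists2 C : R, 0 < C &
  forall w, ext_norm (ext_map M w) <= C * ext_norm w.
Proof.
(* The summand 1 makes [C] positive; its logarithm is taken later. *)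
pose C : R := \sum_(A : {set 'I_d}) ext_norm (wedge_cols M A) + 1.
have C0 : 0 < C by rewrite ltr_wpDl // sumr_ge0 // => A _; apply: ext_norm_ge0.
exists C => // w; apply: ext_norm_le => [|S].
  by rewrite mulr_ge0 ?ext_norm_ge0 // ltW.
rewrite /ext_map sum_ffunE mulrDl mulr_suml.
apply: le_trans (ler_norm_sum _ _ _) _.
apply: ler_wpDr; first by rewrite mul1r ext_norm_ge0.
apply: ler_sum => A _; rewrite ffunE normrM mulrC.
by apply: ler_pM => //; apply: ext_norm_ge.
Qed.

Lemma wedge_basisl (A S : {set 'I_d}) w :
  wedge (ext_basis R A) w S =
  if A \subset S then (-1) ^+ inversions A (S :\: A) * w (S :\: A) else 0.
Proof.
rewrite ffunE; case: ifP => AS.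
  rewrite (bigD1 A) //= ffunE eqxx mulr1 big1 ?addr0 // => B /andP[_ /negPf BA].
  by rewrite ffunE BA mulr0 mul0r.
rewrite big1 // => B BS; rewrite ffunE; case: eqP => [BA|]; last by rewrite mulr0 mul0r.
by rewrite -BA BS in AS.
Qed.

Lemma ext_vec1 (a : 'cV[R]_d) i : ext_vec a [set i] = a i 0.
Proof.
rewrite /ext_vec sum_ffunE (bigD1 i) //= !ffunE eqxx big1 ?addr0.
  by rewrite /GRing.scale /= mulr1.
move=> j ji; rewrite !ffunE; case: eqP => [/set1_inj E|]; last by rewrite scaler0.
by rewrite E eqxx in ji.
Qed.

Lemma ext_vec_homog (a : 'cV[R]_d) : ext_homog 1 (ext_vec a).
Proof.
move=> S S1; rewrite /ext_vec sum_ffunE big1 // => j _; rewrite !ffunE.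
by case: eqP => [SE|]; [rewrite SE cards1 in S1 | rewrite scaler0].
Qed.

Lemma homog1_vec w : ext_homog 1 w -> w = ext_vec (\col_i w [set i]).
Proof.
move=> hw; apply/ffunP => S; have [/cards1P[i ->]|S1] := boolP (#|S| == 1%N).
  by rewrite ext_vec1 mxE.
by rewrite hw // ext_vec_homog.
Qed.

Lemma wedge_vec_homog (a b : 'cV[R]_d) :
  ext_homog 2 (wedge (ext_vec a) (ext_vec b)).
Proof.
move=> S S2; rewrite ffunE big1 // => A AS.
have [A1|A1] := boolP (#|A| == 1%N); last by rewrite ext_vec_homog // mulr0 mul0r.
rewrite (ext_vec_homog b) ?mulr0 //; apply: contra S2 => /eqP.
by rewrite cardsD (finset.setIidPr AS) (eqP A1) => D1; lia.
Qed.

(** These are the Pluecker coordinates: they link nonvanishing of the bivector to [parallel], and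
    its size to products of coordinates. *)
Lemma wedge_vec2 (a b : 'cV[R]_d) (i j : 'I_d) : (i < j)%N ->
  wedge (ext_vec a) (ext_vec b) [set i; j] = a i 0 * b j 0 - a j 0 * b i 0.
Proof.
move=> ij.
have nij : i != j by rewrite -val_eqE neq_ltn ij.
have Di : [set i; j] :\: [set i] = [set j].
  by apply/setP => x; rewrite !inE; have [->|] := eqVneq x i; rewrite ?(negPf nij).
have Dj : [set i; j] :\: [set j] = [set i].
  apply/setP => x; rewrite !inE; have [->|] := eqVneq x j => //=.
  - by rewrite eq_sym (negPf nij).
  - by rewrite orbF.
rewrite ffunE (bigD1 [set i]) /=; last by rewrite finset.sub1set !inE eqxx.
rewrite (bigD1 [set j]) /=; last first.
  by rewrite finset.sub1set !inE eqxx orbT /= (inj_eq set1_inj) eq_sym.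
rewrite Di Dj !inversions11 ij ltnNge (ltnW ij) /= !ext_vec1 expr0 expr1 mul1r mulN1r mulNr.
rewrite big1 ?addr0 // => A /andP[/andP[AS Ai] Aj].
rewrite ext_vec_homog ?mulr0 ?mul0r //; apply/negP => /cards1P[x Ax].
move: AS Ai Aj; rewrite Ax finset.sub1set !inE !(inj_eq set1_inj).
by case/orP => ->.
Qed.

Lemma wedge_vec_integral (a b : 'cV[R]_d) :
  (forall i, a i 0 \is a Num.int) -> (forall i, b i 0 \is a Num.int) ->
  ext_integral (wedge (ext_vec a) (ext_vec b)).
Proof.
have vec_int (c : 'cV[R]_d) :
    (forall i, c i 0 \is a Num.int) -> ext_integral (ext_vec c).
  move=> hc S; have [/cards1P[i ->]|S1] := boolP (#|S| == 1%N).
    by rewrite ext_vec1.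
  by rewrite ext_vec_homog.
move=> ha hb S; rewrite ffunE rpred_sum // => A _.
by rewrite !rpredM ?rpredX ?rpredN ?rpred1 ?vec_int.
Qed.

End Exterior.

(** * Proportional and primitive integer vectors *)

Definition parallel (d : nat) (z w : 'cV[int]_d) :=
  forall i j, z i 0 * w j 0 = z j 0 * w i 0.

(* Taking z of least l^1 norm makes every parallel vector a multiple of z: the
   remainder of a division by z would otherwise be a smaller vector in P. *)
Lemma primitive_vector (d : nat) (P : 'cV[int]_d -> Prop) :
  (exists2 z, z != 0 & P z) ->
  (forall z u (q r : int), q != 0 -> `|r| <= `|q| -> q *: u = r *: z ->
    P z -> P u) ->
  exists z, [/\ z != 0, P z &
    forall w, parallel z w -> exists k : int, w = k *: z].
Proof.
move=> [z0 z0n Pz0] Pstep.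
pose N (z : 'cV[int]_d) := (\sum_i absz (z i 0%R))%N.
pose Q k := `[< exists z, [/\ z != 0, P z & N z = k] >].
have exQ : exists k, Q k by exists (N z0); apply/asboolP; exists z0.
case: (ex_minnP exQ) => k /asboolP[z [zn Pz Nz]] kmin.
exists z; split=> // w zw.
have [i zi] : exists i, z i 0 != 0.
  apply/not_existsP => z_eq0; move/eqP: zn; apply; apply/colP => i.
  by rewrite mxE; apply/eqP/negP => /negP/z_eq0.
set q := z i 0 in zi *; set r := (w i 0%R %% q)%Z.
exists (w i 0%R %/ q)%Z; apply/eqP; rewrite -subr_eq0; apply/negP => un.
(* The remainder of [w] modulo [z]. Parallelism gives [q *: u = r *: z] with [0 <= r < |q|], so no
   coordinate of [u] exceeds that of [z] in absolute value, and the [i]-th one is strictly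
   smaller. *)
set u := w - _ in un *.
have r_ge0 : 0 <= r by apply: modz_ge0.
have r_lt : r < `|q| by apply: ltz_mod.
have wi : w i 0 = (w i 0%R %/ q)%Z * q + r by rewrite {1}(divz_eq (w i 0) q).
have uj j : q * u j 0 = r * z j 0.
  rewrite /u !mxE mulrBr [q * w j 0]zw.
  have -> : r = w i 0 - (w i 0%R %/ q)%Z * q by rewrite {1}wi addrC addKr.
  by ring.
have Pu : P u.
  apply: (Pstep z u q r) => //; first by rewrite ger0_norm // ltW.
  by apply/colP => j; rewrite !mxE -uj !mxE.
have u_le j : (absz (u j 0%R) <= absz (z j 0%R))%N.
  rewrite -lez_nat !abszE -(ler_pM2l (x := `|q|)) ?normr_gt0 //.
  rewrite -normrM uj normrM ler_wpM2r // ger0_norm //; exact: ltW.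
have u_lt : (absz (u i 0%R) < absz (z i 0%R))%N.
  rewrite -ltz_nat !abszE -(ltr_pM2l (x := `|q|)) ?normr_gt0 //.
  rewrite -normrM uj normrM ltr_pM2r ?normr_gt0 // ger0_norm //; exact: ltW.
have : (N u < k)%N.
  rewrite -Nz /N (bigD1 i) //= [X in (_ < X)%N](bigD1 i) //=.
  by rewrite -addSn leq_add // leq_sum.
rewrite ltnNge; apply/negP/negPn; apply: kmin; apply/asboolP.
by exists u; split=> //; apply/negP.
Qed.

(** * The lattice attached to [Theta] and its deformation by the flow *)

(** It shares its first [m] columns with [ell Theta], and the sets in [J] index only these. Its
    inverse is explicit, namely [shear (- Theta)]. *)
Definition shear (R : realType) (m n : nat) (Theta : 'M[R]_(n, m)) :
    'M[R]_(m + n) :=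
  block_mx 1%:M 0 Theta 1%:M.

Lemma shearK (R : realType) (m n : nat) (Theta : 'M[R]_(n, m)) :
  shear Theta *m shear (- Theta) = 1%:M.
Proof.
rewrite /shear mulmx_block !mul1mx !mulmx1 !mulmx0 !mul0mx !addr0 add0r subrr.
by rewrite -scalar_mx_block.
Qed.

Lemma shearNK (R : realType) (m n : nat) (Theta : 'M[R]_(n, m)) :
  shear (- Theta) *m shear Theta = 1%:M.
Proof. by have := shearK (- Theta); rewrite opprK. Qed.

(** Only [2 * M + 1] integers have absolute value at most [M], one fewer than the domain has
    elements. *)
Lemma bounded_int_not_inj (M : nat) (f : 'I_(2 * M).+2 -> int) :
  (forall k, (absz (f k) <= M)%N) -> ~ injective f.
Proof.
move=> fM finj; pose g k : 'I_(2 * M).+1 := inord (absz (f k + M%:Z)).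
have gE k : val (g k) = absz (f k + M%:Z).
  by rewrite /g /= inordK //; have := fM k; lia.
have ginj : injective g.
  move=> k l /(congr1 val); rewrite !gE => fkl; apply: finj.
  by have := fM k; have := fM l; lia.
by have := leq_card g ginj; rewrite !card_ord ltnn.
Qed.

Section Lattice.
Variables (R : realType) (m n : nat) (Theta : 'M[R]_(n, m)).
Hypotheses (m_gt0 : (0 < m)%N) (n_gt0 : (0 < n)%N).
Implicit Types (z w : 'cV[int]_(m + n)) (s : R).

Local Notation beta := (m%:R / n%:R : R).

(** For z = (x, y) this is the vector (x, y - Theta x). *)
Definition lcoord z : 'cV[R]_(m + n) :=
  shear (- Theta) *m map_mx intr z.

Lemma lcoordE z : map_mx intr z = shear Theta *m lcoord z.
Proof. by rewrite /lcoord mulmxA shearK mul1mx. Qed.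

Lemma lcoordB z w : lcoord (z - w) = lcoord z - lcoord w.
Proof. by rewrite /lcoord map_mxB mulmxBr. Qed.

Lemma lcoordZ k z : lcoord (k *: z) = k%:~R *: lcoord z.
Proof. by rewrite /lcoord map_mxZ scalemxAr. Qed.

Lemma lcoordBE z w i : lcoord (z - w) i 0 = lcoord z i 0 - lcoord w i 0.
Proof. by rewrite lcoordB; move: (lcoord z) (lcoord w) => a b; rewrite !mxE. Qed.

Lemma lcoordZE k z i : lcoord (k *: z) i 0 = k%:~R * lcoord z i 0.
Proof. by rewrite lcoordZ; move: (lcoord z) => a; rewrite !mxE. Qed.

Lemma lcoord_inj : injective lcoord.
Proof.
move=> z w zw; apply/colP => i; apply: (@intr_inj R).
by have /matrixP/(_ i 0) := lcoordE z; rewrite zw -lcoordE !mxE.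
Qed.

Lemma lcoord0 : lcoord 0 = 0.
Proof. by rewrite -(subrr 0) lcoordB subrr. Qed.

Lemma lcoord_lshift z i :
  lcoord z (lshift n i) 0 = (z (lshift n i) 0)%:~R.
Proof.
rewrite /lcoord -[map_mx _ _]vsubmxK /shear mul_block_col mul1mx mul0mx addr0.
by rewrite col_mxEu !mxE.
Qed.

Lemma lcoord_rshift z j :
  lcoord z (rshift m j) 0 =
  (z (rshift m j) 0)%:~R - \sum_i Theta j i * (z (lshift n i) 0)%:~R.
Proof.
rewrite /lcoord -[map_mx _ _]vsubmxK /shear mul_block_col mul1mx.
rewrite col_mxEd mul1mx !mxE addrC; congr (_ + _); rewrite -sumrN.
by apply: eq_bigr => i _; rewrite !mxE mulNr.
Qed.

(** The weights sum to m - n beta = 0, which makes the flow unimodular. *)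
Definition weight (i : 'I_(m + n)) : R := if (i < m)%N then 1 else - beta.

Lemma weight_lshift i : weight (lshift n i) = 1.
Proof. by rewrite /weight /= ltn_ord. Qed.

Lemma weight_rshift j : weight (rshift m j) = - beta.
Proof. by rewrite /weight /= ltnNge leq_addr. Qed.

Let beta_gt0 : 0 < beta.
Proof. by rewrite divr_gt0 ?ltr0n. Qed.

Lemma weight_bounds i : - beta <= weight i <= 1.
Proof.
have := beta_gt0; rewrite /weight; case: ifP => _ b0; rewrite lexx ?andbT /=; lra.
Qed.

(* The norm of z in the unimodular lattice deformed by the flow at time s. *)
Definition flow_norm z s : R :=
  \big[Num.max/0]_i (`|lcoord z i 0| * expR (- weight i * s)).

Lemma flow_norm_ge z s i : `|lcoord z i 0| * expR (- weight i * s) <= flow_norm z s.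
Proof. exact: le_bigmax. Qed.

Lemma flow_norm_le z s B : 0 <= B ->
  (forall i, `|lcoord z i 0| <= B * expR (weight i * s)) -> flow_norm z s <= B.
Proof.
move=> B0 H; apply: bigmax_le => // i _.
by rewrite mulNr expRN ler_pdivrMr ?expR_gt0.
Qed.

Lemma lcoord_le z s i : `|lcoord z i 0| <= flow_norm z s * expR (weight i * s).
Proof.
by rewrite -ler_pdivrMr ?expR_gt0 // -expRN -mulNr flow_norm_ge.
Qed.

Lemma flow_norm_attained z s :
  exists i, flow_norm z s = `|lcoord z i 0| * expR (- weight i * s).
Proof.
have i0 : 'I_(m + n) by apply: (lshift n); exact: Ordinal m_gt0.
have ge0 i : predT i -> 0 <= `|lcoord z i 0| * expR (- weight i * s).
  by rewrite mulr_ge0 ?expR_ge0.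
have [i _ E] := @eq_bigmax _ _ _ 0 i0 predT _ isT ge0.
by exists i.
Qed.

Lemma flow_norm_gt0 z s : z != 0 -> 0 < flow_norm z s.
Proof.
move=> zn; rewrite lt_neqAle; apply/andP; split; last first.
  by apply: le_trans (flow_norm_ge z s (lshift n (Ordinal m_gt0))); rewrite mulr_ge0 ?expR_ge0.
apply: contra_neq zn => F0; apply: lcoord_inj; apply/colP => i.
by have := lcoord_le z s i; rewrite -F0 mul0r normr_le0 lcoord0 => /eqP->; rewrite [RHS]mxE.
Qed.

(** Here u = (r/q) z with |r/q| <= 1. This is the closure property that [primitive_vector] asks
    for. *)
Lemma flow_norm_parallel z u s (q r : int) : q != 0 -> `|r| <= `|q| ->
  q *: u = r *: z -> flow_norm u s <= flow_norm z s.
Proof.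
move=> q0 rq E; apply: flow_norm_le => [|i].
  exact: bigmax_ge_id.
apply: le_trans (lcoord_le z s i).
have qR : 0 < `|q%:~R| :> R by rewrite normr_gt0 intr_eq0.
rewrite -(ler_pM2l qR) -normrM -lcoordZE E lcoordZE normrM ler_wpM2r //.
by rewrite -!intr_norm ler_int.
Qed.

Lemma flow_norm_scale_ge z s (k : int) :
  `|k|%:~R * flow_norm z s <= flow_norm (k *: z) s.
Proof.
have [i ->] := flow_norm_attained z s; apply: le_trans (flow_norm_ge _ s i).
by rewrite lcoordZE normrM intr_norm mulrA.
Qed.

(** Forward in time no coordinate shrinks faster than e^-delta, because no weight exceeds 1. *)
Lemma flow_norm_forward z s delta : 0 <= delta ->
  flow_norm z s <= flow_norm z (s + delta) * expR delta.
Proof.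
move=> d0; apply: flow_norm_le => [|i].
  by rewrite mulr_ge0 ?expR_ge0 //; apply: bigmax_ge_id.
apply: le_trans (lcoord_le z (s + delta) i) _.
rewrite -mulrA -expRD ler_wpM2l //; first exact: bigmax_ge_id.
rewrite ler_expR mulrDr addrC lerD2r ler_piMl //.
by have /andP[] := weight_bounds i.
Qed.

(** Backward in time no coordinate shrinks faster than e^(-beta delta), because no weight is below
    -beta. *)
Lemma flow_norm_backward z s delta : 0 <= delta ->
  flow_norm z s <= flow_norm z (s - delta) * expR (beta * delta).
Proof.
move=> d0; apply: flow_norm_le => [|i].
  by rewrite mulr_ge0 ?expR_ge0 //; apply: bigmax_ge_id.
apply: le_trans (lcoord_le z (s - delta) i) _.
rewrite -mulrA -expRD ler_wpM2l //; first exact: bigmax_ge_id.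
rewrite ler_expR mulrBr addrC lerD2r -mulNr ler_wpM2r // lerNl.
by have /andP[] := weight_bounds i.
Qed.

(** Each x in {0, ..., X}^m is completed by y = floor(Theta x), and the cube of fractional parts of
    Theta x is cut into Q^n cells of side 1/Q. Some cell receives more than [K] points, and
    differences within a cell are small. *)
Lemma pigeonhole (X Q K : nat) : (0 < Q)%N -> (K * Q ^ n < X.+1 ^ m)%N ->
  exists2 p : 'I_K.+1 -> 'cV[int]_(m + n), injective p & forall k l,
    (forall i, `|lcoord (p k - p l) (lshift n i) 0| <= X%:R) /\
    (forall j, `|lcoord (p k - p l) (rshift m j) 0| <= Q%:R^-1).
Proof.
move=> Q0 KQX.
pose T := {ffun 'I_m -> 'I_X.+1}.
pose y (x : T) j : R := \sum_i Theta j i * (x i)%:R.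
pose pt (x : T) : 'cV[int]_(m + n) :=
  col_mx (\col_i (x i)%:Z) (\col_j Num.floor (y x j)).
pose frac (x : T) j : R := y x j - (Num.floor (y x j))%:~R.
have frac_itv x j : 0 <= frac x j < 1.
  by rewrite subr_ge0 ltrBlDl floor_le_tmp -[X in _ + X]/(1%:~R) -intrD floorD1_gt.
have cellP (x : T) j : (Num.truncn (frac x j * Q%:R) < Q)%N.
  rewrite -(ltr_nat R); have /andP[f0 f1] := frac_itv x j.
  apply: (@le_lt_trans _ _ (frac x j * Q%:R)); first by rewrite truncn_le mulr_ge0.
  by rewrite gtr_pMl ?ltr0n.
pose cell (x : T) : {ffun 'I_n -> 'I_Q} := [ffun j => Ordinal (cellP x j)].
have [c cK] : exists c, (K < #|[set x | cell x == c]|)%N.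
  apply/not_existsP => cK; move: KQX; apply/negP; rewrite -leqNgt.
  have <- : #|T| = (X.+1 ^ m)%N by rewrite card_ffun !card_ord.
  rewrite -sum1_card (partition_big cell predT) //=.
  apply: (@leq_trans (\sum_(c : {ffun 'I_n -> 'I_Q}) K)).
    apply: leq_sum => c _; have /negP := cK c; rewrite -leqNgt.
    by rewrite -sum1_card; under eq_bigl do rewrite inE.
  by rewrite sum_nat_const card_ffun !card_ord mulnC.
exists (fun k => pt (enum_val (widen_ord cK k))).
  move=> k l /matrixP ekl; apply: val_inj.
  suff /(congr1 val) : widen_ord cK k = widen_ord cK l by [].
  apply/enum_val_inj/ffunP => i.
  have := ekl (lshift n i) 0; rewrite !col_mxEu !mxE => -[]; exact: val_inj.
move=> k l; set xk := enum_val _; set xl := enum_val _.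
have ck : cell xk = c by have := enum_valP (widen_ord cK k); rewrite inE => /eqP.
have cl : cell xl = c by have := enum_valP (widen_ord cK l); rewrite inE => /eqP.
split=> [i|j].
  rewrite lcoordBE !lcoord_lshift /pt !col_mxEu !mxE.
  have := ltn_ord (xk i); have := ltn_ord (xl i); rewrite !ltnS.
  rewrite -!(ler_nat R) -!pmulrn => h1 h2.
  have h3 : 0 <= (xk i)%:R :> R by []. have h4 : 0 <= (xl i)%:R :> R by [].
  rewrite ler_norml; apply/andP; split; lra.
have ptE x : lcoord (pt x) (rshift m j) 0 = - frac x j.
  rewrite lcoord_rshift /pt col_mxEd mxE /frac opprB; congr (_ - _).
  by apply: eq_bigr => i _; rewrite col_mxEu mxE -pmulrn.
rewrite lcoordBE !ptE.
(* Sharing a cell means equal integer parts after scaling by [Q], hence fractional parts less than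
   1/Q apart. *)
have E : Num.truncn (frac xk j * Q%:R) = Num.truncn (frac xl j * Q%:R).
  have : cell xk j = cell xl j by rewrite ck cl.
  by rewrite !ffunE => /(congr1 val).
have /andP[k0 k1] := frac_itv xk j; have /andP[l0 l1] := frac_itv xl j.
have QR : 0 < Q%:R :> R by rewrite ltr0n.
have := truncn_itv (mulr_ge0 k0 (ltW QR)).
have := truncn_itv (mulr_ge0 l0 (ltW QR)).
rewrite E -natr1 => /andP[a1 a2] /andP[b1 b2].
rewrite -(ler_pM2r QR) mulVf ?gt_eqF // -[X in _ * X](gtr0_norm QR) -normrM.
rewrite mulrDl opprK mulNr ler_norml; apply/andP; split; lra.
Qed.

Let expR_betaX s : expR (beta * s) ^+ n = expR s ^+ m.
Proof.
rewrite -!expRM_natl mulrA; congr (expR (_ * _)).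
by rewrite mulrCA divff ?mulr1 // pnatr_eq0 -lt0n.
Qed.

(** Two points in one cell, with box sides e^s and e^(-beta s) up to rounding. The bound 2 absorbs
    the rounding: e^(beta s) < Q + 1 <= 2 Q. *)
Lemma flow_norm_dirichlet s : 0 <= s ->
  exists2 z, z != 0 & flow_norm z s <= 2.
Proof.
move=> s0.
set X := Num.truncn (expR s); set Q := Num.truncn (expR (beta * s)).
have bs0 : 0 <= beta * s by rewrite mulr_ge0 // ltW.
have Q0 : (0 < Q)%N by rewrite /Q truncn_gt0 -[leLHS]expR0 ler_expR.
have QE : Q%:R <= expR (beta * s) by rewrite truncn_le expR_ge0.
have XE : X%:R <= expR s by rewrite truncn_le expR_ge0.
have [|p pinj pP] := @pigeonhole X Q 1 Q0.
  rewrite mul1n -(ltr_nat R) !natrX.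
  apply: (@le_lt_trans _ _ (expR (beta * s) ^+ n)); first by rewrite lerXn2r ?nnegrE ?expR_ge0.
  by rewrite expR_betaX ltrXn2r -?lt0n ?expR_ge0 ?truncnS_gt.
exists (p 1 - p 0).
  by rewrite subr_eq0; apply/eqP => /pinj.
have [P1 P2] := pP 1 0.
apply: flow_norm_le => // i; case: (split_ordP i) => j ->.
  rewrite weight_lshift mul1r; apply: le_trans (P1 j) _.
  by have := expR_gt0 s; lra.
rewrite weight_rshift; apply: le_trans (P2 j) _.
rewrite mulNr expRN ler_pdivlMr ?expR_gt0 // mulrC ler_pdivrMr ?ltr0n //.
have := truncnS_gt (expR (beta * s)); rewrite -/Q -natr1.
have : 1 <= Q%:R :> R by rewrite ler1n.
lra.
Qed.

(* If all lattice points in the box of size mu were multiples of z, there would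
   be at most 2 mu / flow_norm z s + 1 of them. *)
Lemma second_vector z s mu : 0 < s -> z != 0 ->
  (forall w, parallel z w -> exists k : int, w = k *: z) ->
  flow_norm z s <= 1 -> 1 <= mu ->
  2 ^+ n.+2 <= mu ^+ (m + n).-1 * flow_norm z s ->
  exists2 w, ~ parallel z w & flow_norm w s <= mu.
Proof.
move=> s0 zn zprim F1 mu1 muF.
have F0 := flow_norm_gt0 s zn; have mu0 : 0 < mu by lra.
have bs0 : 0 < beta * s by rewrite mulr_gt0.
have [Emu|muE] := leP (expR (beta * s)) mu.
  (* For such large [mu] a unit vector of the last block, of norm e^(beta s), will do. If it were
     parallel to [z], then [z] would have x = 0 and norm at least e^(beta s) > 1. *)
  pose j0 := Ordinal n_gt0.
  pose w : 'cV[int]_(m + n) := delta_mx (rshift m j0) 0.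
  have wl i : w (lshift n i) 0 = 0 by rewrite mxE eq_lrshift.
  have wr j : w (rshift m j) 0 = (j == j0)%:R by rewrite mxE eq_rshift andbT.
  exists w => [zw|].
    have zl i : z (lshift n i) 0 = 0.
      by have := zw (lshift n i) (rshift m j0); rewrite wl wr eqxx mulr1 mulr0.
    have [j zj] : exists j, z (rshift m j) 0 != 0.
      apply/not_existsP => z_eq0; move/eqP: zn; apply; apply/colP => i.
      rewrite mxE; case: (split_ordP i) => j ->; first exact: zl.
      by apply/eqP/negP => /negP/z_eq0.
    have := flow_norm_ge z s (rshift m j).
    rewrite lcoord_rshift big1 ?subr0; last by move=> i _; rewrite zl mulr0.
    rewrite weight_rshift opprK -intr_norm => H.
    have : 1 <= `|z (rshift m j) 0|%:~R :> R by rewrite ler1z -gtz0_ge1 normr_gt0.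
    have : 1 < expR (beta * s) by rewrite expR_gt1.
    set a := expR _ in H *; set b := _%:~R in H *; nra.
  apply: flow_norm_le => [|i]; first exact: ltW.
  case: (split_ordP i) => j ->.
    by rewrite lcoord_lshift wl normr0 mulr_ge0 ?expR_ge0 // ltW.
  rewrite lcoord_rshift wr big1 ?subr0; last by move=> k _; rewrite wl mulr0.
  rewrite weight_rshift mulNr expRN ler_pdivlMr ?expR_gt0 //.
  apply: le_trans Emu; case: (j == j0); rewrite ?normr0 ?mul0r ?expR_ge0 //.
  by rewrite normr1 mul1r.
apply: contrapT => no_w.
have all_par w : flow_norm w s <= mu -> exists k : int, w = k *: z.
  by move=> Fw; apply: zprim; apply: contrapT => nzw; apply: no_w; exists w.
set F := flow_norm z s in F0 F1 muF *.
set E := expR (beta * s) in muE *.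
(* [X] and [Q] describe the box of size [mu] at time [s], rounded so that 1/Q <= mu/E; a multiple k
   z in that box has |k| <= M. *)
set X := Num.truncn (mu * expR s); set Q := (Num.truncn (E / mu)).+1.
set M := Num.truncn (mu / F).
have Emu1 : 1 < E / mu by rewrite ltr_pdivlMr ?mul1r.
have Emu0 : 0 <= E / mu by lra.
have muF0 : 0 <= mu / F by rewrite divr_ge0 // ltW.
have muF1 : 1 <= mu / F by rewrite ler_pdivlMr // mul1r; lra.
have XE : X%:R <= mu * expR s by rewrite truncn_le mulr_ge0 ?expR_ge0 // ltW.
have ME : M%:R <= mu / F by rewrite truncn_le.
have QE : Q%:R <= 2 * (E / mu).
  by rewrite /Q -natr1; have : (Num.truncn (E / mu))%:R <= E / mu; [rewrite truncn_le | lra].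
have [|p pinj pP] := @pigeonhole X Q (2 * M).+1 isT.
  rewrite -(ltr_nat R) natrM !natrX.
  apply: (@le_lt_trans _ _ ((mu * expR s) ^+ m)); last first.
    rewrite ltrXn2r -?lt0n ?mulr_ge0 ?expR_ge0 ?(ltW mu0) //.
    exact: truncnS_gt.
  (* The constant 2^(n+2) comes from 2 M + 1 <= 4 mu / F and Q <= 2 E / mu. *)
  apply: (@le_trans _ _ (2 ^+ 2 * (mu / F) * (2 * (E / mu)) ^+ n)).
    apply: ler_pM; rewrite ?exprn_ge0 //.
      by rewrite -natr1 natrM; lra.
    by rewrite lerXn2r ?nnegrE //; lra.
  rewrite !exprMn expR_betaX exprVn.
  have mun0 : 0 < mu ^+ n by rewrite exprn_gt0.
  have -> : 2 ^+ 2 * (mu / F) * (2 ^+ n * (expR s ^+ m * (mu ^+ n)^-1)) =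
      2 ^+ n.+2 / F * (mu / mu ^+ n * expR s ^+ m).
    have -> : 2 ^+ n.+2 = 2 ^+ n * 2 ^+ 2 :> R by rewrite -exprD addn2.
    move: mun0.
    move: (mu ^+ n) (expR s ^+ m) (2 ^+ n : R) => a b c a0.
    by field; rewrite !gt_eqF.
  apply: (@le_trans _ _ (mu ^+ (m + n).-1 * (mu / mu ^+ n * expR s ^+ m))).
    rewrite ler_wpM2r //; last by rewrite ler_pdivrMr.
    by rewrite mulr_ge0 ?exprn_ge0 ?expR_ge0 // divr_ge0 // ltW.
  rewrite mulrA ler_wpM2r ?exprn_ge0 ?expR_ge0 //.
  rewrite mulrA -exprSr prednK ?addn_gt0 ?m_gt0 // exprD mulfK //.
  by rewrite gt_eqF.
have Fp k : flow_norm (p k - p ord0) s <= mu.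
  have [P1 P2] := pP k ord0.
  apply: flow_norm_le => [|i]; first exact: ltW.
  case: (split_ordP i) => j ->.
    by rewrite weight_lshift mul1r; apply: le_trans (P1 j) _.
  rewrite weight_rshift; apply: le_trans (P2 j) _.
  rewrite mulNr expRN -/E -[mu / E]invf_div lef_pV2 ?posrE ?ltr0n //; last by lra.
  by rewrite ltW // truncnS_gt.
have [f fE] := choice (fun k => all_par _ (Fp k)).
have fM k : (absz (f k) <= M)%N.
  rewrite /M truncn_ge_nat // ler_pdivlMr //; apply: le_trans (Fp k).
  by rewrite fE; apply: le_trans (flow_norm_scale_ge z s (f k)); rewrite -abszE.
have finj : injective f.
  by move=> k l fkl; apply: pinj; apply: (subIr (p ord0)); rewrite !fE fkl.
exact: bounded_int_not_inj fM finj.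
Qed.

End Lattice.

(** * From one short vector to two independent short vectors *)

Section TwoVectors.
Variables (R : realType) (m n : nat) (Theta : 'M[R]_(n, m)).
Hypotheses (m_gt0 : (0 < m)%N) (n_gt0 : (0 < n)%N) (d_ge3 : (3 <= m + n)%N).

Local Notation beta := (m%:R / n%:R : R).
Local Notation norm := (flow_norm Theta).

Definition decay_rate (psi : R) := exists c s1 : R, forall s, s1 <= s ->
  exists2 z, z != 0 & norm z s <= expR (c - psi * s).

Definition plane_decay_rate (phi : R) := exists c s1 : R, forall s, s1 <= s ->
  exists z w, ~ parallel z w /\ norm z s * norm w s <= expR (c - phi * s).

Lemma decay_rate_le psi psi' : psi' <= psi -> decay_rate psi -> decay_rate psi'.
Proof.
move=> le_psi [c [s1 H]]; exists c, (Num.max s1 0) => s.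
rewrite ge_max => /andP[s1s s0]; have [z zn zs] := H s s1s; exists z => //.
apply: le_trans zs _; rewrite ler_expR lerD2l lerN2; exact: ler_wpM2r.
Qed.

Lemma decay_rate0 : decay_rate 0.
Proof.
exists (ln 2), 0 => s s0; have [z zn zs] := flow_norm_dirichlet Theta m_gt0 n_gt0 s0.
by exists z => //; rewrite mul0r subr0 lnK // posrE.
Qed.

(* An affine function of a is minimal at an endpoint. *)
Lemma affine_ge (psi phi A kappa c s a : R) : 0 <= kappa -> 0 <= c -> 0 <= s ->
  phi <= 2 * psi -> phi <= A + psi - kappa * (A - psi) ->
  psi * s - c <= a -> a <= A * s ->
  phi * s - c <= a + psi * s - kappa * (a - psi * s).
Proof.
move=> k0 c0 s0 phi1 phi2 a1 a2.
have e1 : phi * s <= 2 * psi * s by rewrite ler_wpM2r.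
have [k1|k1] := leP kappa 1.
  have : 0 <= (1 - kappa) * (a - (psi * s - c)) by rewrite mulr_ge0 // subr_ge0.
  have : 0 <= kappa * c by rewrite mulr_ge0.
  by nra.
have : phi * s <= (A + psi - kappa * (A - psi)) * s by rewrite ler_wpM2r.
have : 0 <= (kappa - 1) * (A * s - a) by rewrite mulr_ge0 // subr_ge0 // ltW.
nra.
Qed.

(** [A] separates the two methods of finding [w]. For a >= A s counting gives a product of about
    e^(-a (1 - 1/(d-1))). For a < A s the vector [w] is taken at a later or earlier time, and the
    resulting exponent is affine in a; the remaining bounds on [phi] are its values at the endpoints
    psi s and A s. *)
Lemma plane_decay (psi phi A : R) :
  0 <= psi -> psi < 1 -> 0 <= A -> A < 1 ->
  phi <= A * (1 - (m + n).-1%:R^-1) -> phi <= 2 * psi ->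
  phi <= A + psi - (1 - psi) / (beta + psi) * (A - psi) ->
  phi <= A + psi - (beta + psi) / (1 - psi) * (A - psi) ->
  decay_rate psi -> plane_decay_rate phi.
Proof.
move=> psi0 psi1 A0 A1 phiA phi2 phif phib [c [s1 H]].
have beta0 : 0 < beta by rewrite divr_gt0 ?ltr0n.
wlog c0 : c H / 0 <= c.
  move=> /(_ (Num.max c 0)); apply; last by rewrite le_max lexx orbT.
  move=> s /H[z zn zs]; exists z => //; apply: le_trans zs _.
  by rewrite ler_expR lerD2r le_max lexx.
set D := (m + n).-1 in phiA.
have D_gt0 : (0 < D)%N by rewrite /D; lia.
have D0 : 0 < D%:R :> R by rewrite ltr0n.
set rho := D%:R^-1 in phiA.
have rho0 : 0 < rho by rewrite invr_gt0.
pose kf := (1 - psi) / (beta + psi); pose kb := (beta + psi) / (1 - psi).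
have kf0 : 0 <= kf by rewrite divr_ge0 //; lra.
have kb0 : 0 <= kb by rewrite divr_ge0 //; lra.
(* The sum of the error constants of the three cases: counting, forward, backward. *)
pose c2 := rho * (n.+2%:R * ln 2) + (2 * c + kf * (c + 1)) + (2 * c + kb * (c + 1)).
have ln2 : 0 < ln 2 :> R by rewrite ln_gt0 // ltr1n.
have c2a : 0 <= rho * (n.+2%:R * ln 2) by rewrite !mulr_ge0 // ltW.
have c2b : 0 <= kf * (c + 1) by rewrite mulr_ge0 //; lra.
have c2c : 0 <= kb * (c + 1) by rewrite mulr_ge0 //; lra.
(* The last term ensures that the backward case does not leave the range s >= s1. *)
pose s2 := Num.max (Num.max s1 1) (((1 - psi) * s1 + (c + 1)) / (1 - A)).
exists c2, s2 => s; rewrite !ge_max => /andP[/andP[s1s s_ge1] s2s].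
have s0 : 0 < s by lra.
have [z [zn zs zprim]] := @primitive_vector _ (fun z => norm z s <= expR (c - psi * s))
  (H s s1s) (fun z u q r q0 rq E Pz => le_trans (flow_norm_parallel Theta s q0 rq E) Pz).
have Fz0 := flow_norm_gt0 Theta m_gt0 s zn.
set a := - ln (norm z s).
have Fz : norm z s = expR (- a) by rewrite opprK lnK.
have a_ge : psi * s - c <= a by move: zs; rewrite Fz ler_expR; lra.
(* A nonzero multiple of [z] is at least as long as [z] at every time, so being shorter at one time
   [s'] excludes parallelism. *)
have not_parallel w s' : w != 0 -> norm w s' < norm z s' -> ~ parallel z w.
  move=> wn wlt /zprim[k wk]; move: wlt; apply/negP; rewrite -leNgt.
  have k0 : k != 0 by apply: contra_neq wn => k0; rewrite wk k0 scale0r.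
  apply: (@flow_norm_parallel _ _ _ _ _ _ _ k 1) => //.
    by rewrite normr1 -gtz0_ge1 normr_gt0.
  by rewrite scale1r wk.
have [a_big|a_small] := leP (A * s) a.
  (* Chosen to give equality in the size hypothesis of [second_vector]. *)
  pose mu := expR (rho * (n.+2%:R * ln 2 + a)).
  have a0 : 0 <= a by apply: le_trans a_big; rewrite mulr_ge0 // ltW.
  have muD : mu ^+ D = 2 ^+ n.+2 * expR a.
    rewrite /mu -expRM_natl mulrA divff ?gt_eqF // mul1r expRD expRM_natl.
    by rewrite lnK // posrE.
  have [|||w zw ws] := @second_vector _ _ _ Theta m_gt0 n_gt0 z s mu s0 zn zprim.
  - by rewrite Fz -[leRHS]expR0 ler_expR oppr_le0.
  - rewrite -[leLHS]expR0 ler_expR mulr_ge0 ?(ltW rho0) // addr_ge0 //.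
    by rewrite mulr_ge0 // ltW.
  - by rewrite -/D muD Fz expRN mulfK // gt_eqF // expR_gt0.
  exists z, w; split=> //.
  apply: (@le_trans _ _ (expR (- a) * mu)).
    by rewrite Fz ler_wpM2l ?expR_ge0.
  rewrite /mu -expRD ler_expR.
  have rho1 : rho <= 1 by rewrite invf_le1 // ler1n.
  have : phi * s <= A * (1 - rho) * s by rewrite ler_wpM2r // ltW.
  have : A * s * (1 - rho) <= a * (1 - rho) by rewrite ler_wpM2r // subr_ge0.
  rewrite /c2; lra.
have [i Fi] := flow_norm_attained Theta m_gt0 z s.
have [/eqP wi|wi] : (weight R i == - beta) \/ (weight R i == 1).
  by rewrite /weight; case: ifP => _; rewrite eqxx; [right|left].
(* Going forward, [z] has norm at least e^(-a + beta delta). This [delta] makes it exceed the bound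
   e^(c - psi (s + delta)) on the short vector by exactly a factor e; returning to time [s] costs
   e^delta. *)
- pose delta := (a - psi * s + c + 1) / (beta + psi).
  have bp : 0 < beta + psi by lra.
  have d0 : 0 <= delta by rewrite divr_ge0 //; lra.
  have dE : (beta + psi) * delta = a - psi * s + c + 1.
    by rewrite /delta mulrCA divff ?mulr1 // gt_eqF.
  have [|w wn ws] := H (s + delta); first by lra.
  have zd : expR (- a + beta * delta) <= norm z (s + delta).
    apply: le_trans (flow_norm_ge _ _ _ i).
    rewrite expRD -Fz Fi -mulrA wi opprK mulrDr expRD; lra.
  exists z, w; split.
    apply: (not_parallel w (s + delta)) => //; apply: le_lt_trans ws _.
    by apply: lt_le_trans zd; rewrite ltr_expR; lra.
  have ws' : norm w s <= expR (c - psi * (s + delta) + delta).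
    apply: le_trans (flow_norm_forward Theta m_gt0 n_gt0 w s d0) _; rewrite expRD.
    by rewrite ler_wpM2r ?expR_ge0.
  apply: (@le_trans _ _ (expR (- a) * expR (c - psi * (s + delta) + delta))).
    by rewrite Fz ler_wpM2l ?expR_ge0.
  rewrite -expRD ler_expR.
  have := affine_ge kf0 c0 (ltW s0) phi2 phif a_ge (ltW a_small).
  have : kf * (a - psi * s + c + 1) = (1 - psi) * delta.
    by rewrite /kf /delta mulrAC -mulrA.
  rewrite /c2; lra.
(* The mirror image: going backward [z] has norm at least e^(-a + delta), again a factor e above the
   bound, and returning costs e^(beta delta). *)
- pose delta := (a - psi * s + c + 1) / (1 - psi).
  have bp : 0 < 1 - psi by lra.
  have d0 : 0 <= delta by rewrite divr_ge0 //; lra.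
  have dE : (1 - psi) * delta = a - psi * s + c + 1.
    by rewrite /delta mulrCA divff ?mulr1 // gt_eqF.
  have [|w wn ws] := H (s - delta).
    rewrite -(ler_pM2l bp) mulrBr dE.
    by move: s2s; rewrite ler_pdivrMr ?subr_gt0 // => s2s; lra.
  have zd : expR (- a + delta) <= norm z (s - delta).
    apply: le_trans (flow_norm_ge _ _ _ i).
    rewrite expRD -Fz Fi -mulrA (eqP wi) !mulN1r opprB addrC expRD; lra.
  exists z, w; split.
    apply: (not_parallel w (s - delta)) => //; apply: le_lt_trans ws _.
    by apply: lt_le_trans zd; rewrite ltr_expR; lra.
  have ws' : norm w s <= expR (c - psi * (s - delta) + beta * delta).
    apply: le_trans (flow_norm_backward Theta m_gt0 n_gt0 w s d0) _; rewrite expRD.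
    by rewrite ler_wpM2r ?expR_ge0.
  apply: (@le_trans _ _ (expR (- a) * expR (c - psi * (s - delta) + beta * delta))).
    by rewrite Fz ler_wpM2l ?expR_ge0.
  rewrite -expRD ler_expR.
  have := affine_ge kb0 c0 (ltW s0) phi2 phib a_ge (ltW a_small).
  have : kb * (a - psi * s + c + 1) = (beta + psi) * delta.
    by rewrite /kb /delta mulrAC -mulrA.
  rewrite /c2; lra.
Qed.

End TwoVectors.

(** * Translation between the defining systems and decay along the flow *)

Section UniformSolvability.
Variables (R : realType) (m n : nat) (Theta : 'M[R]_(n, m)).
Hypotheses (m_gt0 : (0 < m)%N) (n_gt0 : (0 < n)%N).

Local Notation beta := (m%:R / n%:R : R).
Local Notation base := [set lshift n i | i : 'I_m].

Let beta_gt0 : 0 < beta.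
Proof. by rewrite divr_gt0 ?ltr0n. Qed.

Lemma in_base (i : 'I_(m + n)) : (i \in base) = (i < m)%N.
Proof.
apply/imsetP/idP => [[j _ ->]|im]; first by rewrite /= ltn_ord.
by exists (Ordinal im) => //; apply: val_inj.
Qed.

Lemma card_base : #|base| = m.
Proof. by rewrite card_imset ?card_ord //; apply: lshift_inj. Qed.

Lemma card_sub_base (sigma : {set 'I_(m + n)}) :
  sigma \subset base -> (#|sigma| <= m)%N.
Proof. by move/subset_leq_card; rewrite card_base. Qed.

Lemma wedge_cols_ell (sigma : {set 'I_(m + n)}) : sigma \subset base ->
  wedge_cols (ell Theta) sigma = wedge_cols (shear Theta) sigma.
Proof.
move=> /fintype.subsetP sb; apply: eq_big_seq => i; rewrite mem_enum => /sb/imsetP[j _ ->].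
by rewrite /ell /shear !block_mxEh !colKl.
Qed.

(** The map induced by [shear Theta] sends the basis element of [sigma] to L_sigma, so wedging with
    L_sigma becomes wedging with a basis element. *)
Lemma ell_wedge_vec (sigma : {set 'I_(m + n)}) w : sigma \subset base ->
  wedge (wedge_cols (ell Theta) sigma) (ext_map (shear Theta) w) =
  ext_map (shear Theta) (wedge (ext_basis R sigma) w).
Proof.
move=> sb; rewrite wedge_cols_ell // -wedge_cols_basis ext_map_wedge_cols.
by rewrite mulmx1.
Qed.

Lemma basis_wedge_vec (sigma : {set 'I_(m + n)}) w : sigma \subset base ->
  wedge (ext_basis R sigma) (ext_map (shear (- Theta)) w) =
  ext_map (shear (- Theta)) (wedge (wedge_cols (ell Theta) sigma) w).
Proof.
by move=> sb; rewrite wedge_cols_ell // ext_map_wedge_cols shearNK wedge_cols_basis.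
Qed.

(** Put t = e^(q s). The sets [sigma] of size m - 1 bound each x-coordinate by a constant times t,
    and the full set of size m bounds y - Theta x by a constant times t^-alpha. With q = (1 +
    beta)/(1 + alpha) both are the flow bound, as q = 1 - psi and -alpha q = -beta - psi. *)
Lemma uniform_solvable1_decay alpha : -1 < alpha ->
  uniform_solvable Theta 1 alpha ->
  decay_rate Theta ((alpha - beta) / (1 + alpha)).
Proof.
move=> alpha1 [T [_ HT]].
have [C C0 HC] := ext_map_bounded (shear (- Theta)).
have a1 : 0 < 1 + alpha by lra.
pose q := (1 + beta) / (1 + alpha).
have q0 : 0 < q by rewrite divr_gt0 // addr_gt0.
(* From this time on t is at least max(T, 1) + 1, hence beyond [T]; the maximum keeps the logarithm
   meaningful when [T] is negative. *)
exists (ln C), (ln (Num.max T 1 + 1) / q) => s s1.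
set t := expR (q * s).
have Tt : T < t.
  apply: (@lt_le_trans _ _ (Num.max T 1 + 1)).
    by apply: (@le_lt_trans _ _ (Num.max T 1)); [rewrite le_max lexx | rewrite ltrDl].
  have M0 : 0 < Num.max T 1 + 1 by rewrite ltr_wpDl // le_max ler01 orbT.
  by move: s1; rewrite ler_pdivrMr // mulrC -ler_expR lnK.
have [Z [Zhom Zint Z0 HZ]] := HT t Tt.
pose z : 'cV[int]_(m + n) := \col_i Num.floor (Z [set i]).
have ZE : Z = ext_vec (map_mx intr z).
  rewrite [LHS]homog1_vec //; congr ext_vec; apply/colP => i.
  by rewrite !mxE; have /floorK := Zint [set i].
have cE : ext_map (shear (- Theta)) Z = ext_vec (lcoord Theta z).
  by rewrite ZE ext_map_vec.
(* Up to sign, coordinate [i] of [z] reappears at [i |: sigma] after wedging with the basis element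
   of [sigma]. *)
have bound (sigma : {set 'I_(m + n)}) i : sigma \subset base -> i \notin sigma ->
    `|lcoord Theta z i 0| <= C * t `^ (1 - (#|sigma|%:R - (m - 1)%N%:R) * (1 + alpha)).
  move=> sb si.
  have sk : (#|sigma| <= m)%N by apply: card_sub_base.
  apply: le_trans (_ : C * ext_norm (wedge (wedge_cols (ell Theta) sigma) Z) <= _).
    apply: le_trans (HC _); rewrite -basis_wedge_vec // cE.
    apply: le_trans (ext_norm_ge _ (i |: sigma)); rewrite wedge_basisl finset.subsetUr.
    rewrite normrM normrX normrN1 expr1n mul1r.
    have -> : (i |: sigma) :\: sigma = [set i].
      apply/setP => j; rewrite !inE.
      by have [->|] := eqVneq j i; rewrite ?(negPf si) //= andbC andbN.
    by rewrite ext_vec1.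
  rewrite ler_wpM2l ?(ltW C0) //; apply: le_trans (HZ _ sk).
  by apply: (le_bigmax_cond _ (j := sigma)); rewrite inE sb eqxx.
have tE x : t `^ x = expR (x * (q * s)) by rewrite /powR gt_eqF ?expR_gt0 // expRK.
have m1 : (m - 1)%N%:R = m%:R - 1 :> R by rewrite natrB.
exists z.
  apply: contra_neq Z0 => z0; rewrite ZE z0; apply/ffunP => S.
  rewrite /ext_vec sum_ffunE ffunE big1 // => i _.
  by rewrite !mxE /= mulr0z scale0r ffunE.
apply: flow_norm_le => [|i]; first exact: expR_ge0.
case: (split_ordP i) => j ->.
  have nj : lshift n j \notin base :\ lshift n j by rewrite !inE eqxx.
  have := bound _ _ (finset.subsetDl _ _) nj; rewrite weight_lshift mul1r.
  have -> : #|base :\ lshift n j| = (m - 1)%N.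
    have := cardsD1 (lshift n j) base; rewrite card_base in_base /= ltn_ord; lia.
  rewrite subrr mul0r subr0 tE mul1r => H; apply: le_trans H _.
  rewrite expRD lnK ?posrE // -[leRHS]mulrA ler_wpM2l ?(ltW C0) // -expRD ler_expR.
  rewrite /q le_eqVlt; apply/orP; left; apply/eqP.
  by move: beta => b; field; rewrite gt_eqF.
have nj : rshift m j \notin base by rewrite in_base /= -leqNgt leq_addr.
have := bound _ _ (fintype.subxx _) nj.
rewrite weight_rshift card_base m1 tE => H; apply: le_trans H _.
rewrite expRD lnK ?posrE // -[leRHS]mulrA ler_wpM2l ?(ltW C0) // -expRD ler_expR.
have -> : m%:R - (m%:R - 1) = 1 :> R by lra.
rewrite /q le_eqVlt; apply/orP; left; apply/eqP.
by move: beta => b; field; rewrite gt_eqF.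
Qed.

(* The fastest expansion of a plane: if m = 1 only one direction expands. *)
Definition plane_weight : R := if m == 1%N then 1 - beta else 2.

(** Each of the two indices outside the first block lowers the weight sum by 1 + beta from 2, and at
    most m - |sigma| of them lie in that block. For m = 1 the truncation [m - 2 = 0] is off by one,
    which [plane_weight] = 2 - (1 + beta) makes up for. *)
Lemma weight_pair (sigma : {set 'I_(m + n)}) i j : sigma \subset base ->
  i != j -> i \notin sigma -> j \notin sigma ->
  weight R i + weight R j <=
  plane_weight - (#|sigma|%:R - (m - 2)%N%:R) * (1 + beta).
Proof.
move=> sb ij si sj.
have sk : (#|sigma| <= m)%N by apply: card_sub_base.
have card1 (k : 'I_(m + n)) : (k < m)%N -> k \notin sigma -> (#|sigma| <= m - 1)%N.
  move=> km ks; have : k |: sigma \subset base.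
    by rewrite finset.subUset finset.sub1set in_base km sb.
  by move/subset_leq_card; rewrite card_base cardsU1 ks add1n subn1 => H; rewrite -ltnS prednK.
have card2 : (i < m)%N -> (j < m)%N -> (2 <= m)%N /\ (#|sigma| <= m - 2)%N.
  move=> im jm.
  have : i |: (j |: sigma) \subset base.
    by rewrite !finset.subUset !finset.sub1set !in_base im jm sb.
  move/subset_leq_card; rewrite card_base !cardsU1 !inE (negPf ij) si sj !add1n => H.
  have m2 : (2 <= m)%N by exact: leq_trans H.
  by split; rewrite // leq_subRL.
have b0 := beta_gt0.
have b1 : 0 <= 1 + beta by lra.
have le_nat a b : (a <= b)%N -> a%:R * (1 + beta) <= b%:R * (1 + beta).
  by move=> ab; rewrite ler_wpM2r ?ler_nat.
rewrite mulrBl /weight /plane_weight; set b := beta in b0 b1 le_nat *.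
have := le_nat _ _ sk; have := card1 i; have := card1 j; move: card2.
have [im|im] := ltnP i m; have [jm|jm] := ltnP j m => card2 cj ci.
- have [//|//|m2 /le_nat] := card2; rewrite (_ : (m == 1%N) = false); last by lia.
  by move=> *; lra.
- have := le_nat _ _ (ci isT si); case: eqP => m1.
    have [-> ->] : (m - 1 = 0)%N /\ (m - 2 = 0)%N by lia.
    by rewrite !mul0r; move=> *; lra.
  have -> : (m - 1 = (m - 2).+1)%N by lia.
  by rewrite -natr1; move=> *; lra.
- have := le_nat _ _ (cj isT sj); case: eqP => m1.
    have [-> ->] : (m - 1 = 0)%N /\ (m - 2 = 0)%N by lia.
    by rewrite !mul0r; move=> *; lra.
  have -> : (m - 1 = (m - 2).+1)%N by lia.
  by rewrite -natr1; move=> *; lra.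
- case: eqP => m1.
    have -> : (m - 2 = 0)%N by lia.
    have -> : m%:R = 1 :> R by rewrite m1.
    by rewrite !mul0r; move=> *; lra.
  have : m%:R = (m - 2)%N%:R + 2 :> R by rewrite -natrD; congr _%:R; lia.
  move=> -> H.
  by lra.
Qed.

Lemma plane_wedge_le z w (sigma : {set 'I_(m + n)}) s : sigma \subset base ->
  0 <= s ->
  ext_norm (wedge (ext_basis R sigma)
     (wedge (ext_vec (lcoord Theta z)) (ext_vec (lcoord Theta w)))) <=
  2 * (flow_norm Theta z s * flow_norm Theta w s) *
  expR ((plane_weight - (#|sigma|%:R - (m - 2)%N%:R) * (1 + beta)) * s).
Proof.
move=> sb s0.
have F0 y : 0 <= flow_norm Theta y s by exact: bigmax_ge_id.
set B := (X in _ <= X).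
have B0 : 0 <= B by rewrite /B !mulr_ge0 ?expR_ge0.
apply: ext_norm_le => // S; rewrite wedge_basisl; case: ifP => sS; last by rewrite normr0.
rewrite normrM normrX normrN1 expr1n mul1r.
have [S2|S2] := eqVneq #|S :\: sigma| 2%N; last by rewrite wedge_vec_homog ?normr0.
have /cards2P[i0 [j0 [ij0 SE0]]] := introT eqP S2.
have [i [j [ij SE]]] : exists i j : 'I_(m + n), (i < j)%N /\ S :\: sigma = [set i; j].
  have := ij0; rewrite -val_eqE neq_ltn => /orP[ij|ij]; first by exists i0, j0.
  by exists j0, i0; rewrite finset.setUC.
have si : i \notin sigma.
  have : i \in S :\: sigma by rewrite SE !inE eqxx.
  by rewrite inE => /andP[].
have sj : j \notin sigma.
  have : j \in S :\: sigma by rewrite SE !inE eqxx orbT.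
  by rewrite inE => /andP[].
have nij : i != j by rewrite -val_eqE neq_ltn ij.
rewrite SE wedge_vec2 //; apply: le_trans (ler_normB _ _) _; rewrite !normrM.
have prod_le k l : k != l -> k \notin sigma -> l \notin sigma ->
    `|lcoord Theta z k 0| * `|lcoord Theta w l 0| <= B / 2.
  move=> kl sk sl.
  apply: (@le_trans _ _ (flow_norm Theta z s * expR (weight R k * s) *
     (flow_norm Theta w s * expR (weight R l * s)))).
    by apply: ler_pM => //; apply: lcoord_le.
  rewrite mulrACA -expRD -mulrDl /B mulrC -!mulrA.
  set W := plane_weight - _.
  rewrite [leRHS](_ : _ = flow_norm Theta z s *
    (flow_norm Theta w s * expR (W * s))); last by field.
  rewrite mulrC -mulrA; do 2 apply: ler_wpM2l => //.
  by rewrite ler_expR ler_wpM2r // weight_pair.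
have := prod_le i j nij si sj.
have nji : j != i by rewrite eq_sym.
have := prod_le j i nji sj si.
lra.
Qed.

(** The solution is the bivector of [z] and [w] at the time s given by t = e^(q s). The strict
    inequality leaves a margin e^(eps s), which eventually absorbs all constants. *)
Lemma plane_decay_uniform_solvable2 phi gamma : -1 < gamma ->
  (plane_weight - phi) * (1 + gamma) < 1 + beta ->
  plane_decay_rate Theta phi -> uniform_solvable Theta 2 gamma.
Proof.
move=> gamma1 phig [c [s1 H]].
have [C C0 HC] := ext_map_bounded (shear Theta).
have g1 : 0 < 1 + gamma by lra.
have b1 : 0 < 1 + beta by rewrite addr_gt0.
pose q := (1 + beta) / (1 + gamma).
have q0 : 0 < q by rewrite divr_gt0.
pose eps := q - (plane_weight - phi).
have eps0 : 0 < eps by rewrite subr_gt0 /q ltr_pdivlMr.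
pose s2 := Num.max (Num.max s1 0) ((c + ln (C * 2)) / eps).
exists (expR (q * s2)); split; first exact: num_real.
move=> t ht; have t0 : 0 < t by apply: lt_trans ht; apply: expR_gt0.
have [s tE] : exists s, ln t = q * s.
  by exists (ln t / q); rewrite mulrCA divff ?mulr1 // gt_eqF.
have : s2 <= s.
  by rewrite -(ler_pM2l q0) -tE -ler_expR lnK // ltW.
rewrite !ge_max ler_pdivrMr // => /andP[/andP[s1s s0] epss].
have [z [w [zw Fzw]]] := H s s1s.
exists (wedge (ext_vec (map_mx intr z)) (ext_vec (map_mx intr w))); split.
- exact: wedge_vec_homog.
- by apply: wedge_vec_integral => i; rewrite mxE intr_int.
(* A zero bivector has zero minors, which would make [z] and [w] parallel. *)
- apply/eqP => Z0; apply: zw => i j.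
  wlog ij : i j / (i < j)%N.
    by move=> W; have [/W//|/W//|/val_inj->//] := ltngtP i j.
  have := wedge_vec2 (map_mx intr z) (map_mx intr w : 'cV[R]_(m + n)) ij.
  rewrite Z0 ffunE !mxE => /esym/eqP; rewrite subr_eq0 -!intrM => /eqP.
  by move/intr_inj.
move=> k km; apply: bigmax_le => [|sigma]; first exact: powR_ge0.
rewrite inE => /andP[sb /eqP <-].
rewrite !(lcoordE Theta) -(ext_map_vec (shear Theta) (lcoord Theta w)).
rewrite -ext_map_wedge_vec ell_wedge_vec //.
apply: le_trans (HC _) _.
apply: le_trans (ler_wpM2l (ltW C0) (plane_wedge_le z w sb s0)) _.
rewrite /powR gt_eqF // tE.
set W := #|sigma|%:R - _.
apply: (@le_trans _ _ (C * 2 *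
    (expR (c - phi * s) * expR ((plane_weight - W * (1 + beta)) * s)))).
  rewrite -(mulrA C 2) ler_wpM2l ?(ltW C0) // -(mulrA 2) ler_wpM2l //.
  by rewrite ler_wpM2r ?expR_ge0.
have C2 : 0 < C * 2 by rewrite mulr_gt0.
rewrite -[X in X * _](lnK C2) -!expRD ler_expR.
have -> : (1 - W * (1 + gamma)) * (q * s) = q * s - W * (1 + beta) * s.
  by rewrite /q; field; rewrite ?pnatr_eq0 -?lt0n ?n_gt0 ?gt_eqF.
rewrite /eps in epss; lra.
Qed.

End UniformSolvability.

(** * Real arithmetic behind the choice of parameters *)

Section Arithmetic.
Variable R : realFieldType.
Implicit Types (d b a psi e g M N p q : R).

(** These are the conditions of [plane_decay] for A = (d-1)e and phi = (d-2)e. The value of [e] is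
    the one giving equality in the forward condition (the third); the second and fourth reduce to e
    d (1 - a) >= 0. *)
Lemma flow_bounds_le1 d b a psi e : 3 <= d -> 0 < b -> b <= a -> a <= 1 ->
  d * a - (d - 1) * b < d - 1 ->
  psi * (1 + a) = a - b -> e * (d - 1 - a) = a - b -> 0 <= e ->
  [/\ (d - 1) * e < 1, (d - 2) * e <= 2 * psi,
      (d - 2) * e <= (d - 1) * e + psi - a^-1 * ((d - 1) * e - psi) &
      (d - 2) * e <= (d - 1) * e + psi - a * ((d - 1) * e - psi)].
Proof.
move=> d3 b0 ba a1 H psiE eE e0; have a0 : 0 < a by lra.
have k : 0 <= e * (d * (1 - a)) by rewrite mulr_ge0 // mulr_ge0; lra.
split.
- have d0 : 0 < d - 1 - a by lra.
  rewrite -(ltr_pM2r d0) -mulrA eE; lra.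
- have d0 : 0 < 1 + a by lra.
  rewrite -(ler_pM2r d0) -[leRHS]mulrA psiE -eE; lra.
- rewrite -(ler_pM2r a0) [leRHS]mulrBl [a^-1 * _]mulrC divfK ?gt_eqF //; lra.
- lra.
Qed.

(** Now [e] gives equality in the backward condition (the fourth), and the second and third reduce
    to e d (a - 1) >= 0. *)
Lemma flow_bounds_ge1 d b a psi e : 3 <= d -> 0 < b -> b <= a -> 1 <= a ->
  1 < (d - 1) * b ->
  psi * (1 + a) = a - b -> e * ((d - 1) * a - 1) = a - b -> 0 <= e ->
  [/\ (d - 1) * e < 1, (d - 2) * e <= 2 * psi,
      (d - 2) * e <= (d - 1) * e + psi - a^-1 * ((d - 1) * e - psi) &
      (d - 2) * e <= (d - 1) * e + psi - a * ((d - 1) * e - psi)].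
Proof.
move=> d3 b0 ba a1 H psiE eE e0; have a0 : 0 < a by lra.
have k : 0 <= e * (d * (a - 1)) by rewrite mulr_ge0 // mulr_ge0; lra.
have k1 : 0 <= (d - 1) * (a - 1) by rewrite mulr_ge0; lra.
split.
- have d0 : 0 < (d - 1) * a - 1 by lra.
  rewrite -(ltr_pM2r d0) -mulrA eE; lra.
- have d0 : 0 < 1 + a by lra.
  rewrite -(ler_pM2r d0) -[leRHS]mulrA psiE -eE; lra.
- rewrite -(ler_pM2r a0) [leRHS]mulrBl [a^-1 * _]mulrC divfK ?gt_eqF //; lra.
- lra.
Qed.

(** Here [g] stands for 1 + gamma. The hypothesis is the claimed bound with denominators cleared,
    the conclusion is what [plane_decay_uniform_solvable2] needs; the two differences are positive
    multiples of each other. *)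
Lemma solvable_cond_le1 M N a g : 1 <= M -> 1 <= N -> 0 < M + N - 1 - a ->
  g * (M + N - 2 + N * (1 - a)) < M + N - 2 + (1 - a) ->
  (2 - (M + N - 2) * ((a - M / N) / (M + N - 1 - a))) * g < 1 + M / N.
Proof.
move=> M1 N1 d0 H; rewrite -subr_lt0.
have -> : (2 - (M + N - 2) * ((a - M / N) / (M + N - 1 - a))) * g - (1 + M / N) =
    (M + N) / (N * (M + N - 1 - a)) *
    (g * (M + N - 2 + N * (1 - a)) - (M + N - 2 + (1 - a))).
  by field; rewrite !gt_eqF //; lra.
rewrite pmulr_rlt0 ?subr_lt0 // divr_gt0 ?mulr_gt0 //; lra.
Qed.

Lemma solvable_cond_ge1 M N a g : 1 <= M -> 1 <= N -> 0 < (M + N - 1) * a - 1 ->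
  g * (N * a + M - 2) < (M + N - 1) * a - 1 ->
  (2 - (M + N - 2) * ((a - M / N) / ((M + N - 1) * a - 1))) * g < 1 + M / N.
Proof.
move=> M1 N1 d0 H; rewrite -subr_lt0.
have -> : (2 - (M + N - 2) * ((a - M / N) / ((M + N - 1) * a - 1))) * g - (1 + M / N) =
    (M + N) / (N * ((M + N - 1) * a - 1)) *
    (g * (N * a + M - 2) - ((M + N - 1) * a - 1)).
  by field; rewrite !gt_eqF //; lra.
rewrite pmulr_rlt0 ?subr_lt0 // divr_gt0 ?mulr_gt0 //; lra.
Qed.

Lemma solvable_cond_dim1 N a g : 1 <= N -> 0 < 1 + N - 1 - a ->
  g * (N - 1) * (1 - a) < N - a ->
  (1 - 1 / N - (1 + N - 2) * ((a - 1 / N) / (1 + N - 1 - a))) * g < 1 + 1 / N.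
Proof.
move=> N1 d0 H; rewrite -subr_lt0.
have -> : (1 - 1 / N - (1 + N - 2) * ((a - 1 / N) / (1 + N - 1 - a))) * g - (1 + 1 / N) =
    (1 + N) / (N * (1 + N - 1 - a)) * (g * (N - 1) * (1 - a) - (N - a)).
  by field; rewrite !gt_eqF //; lra.
rewrite pmulr_rlt0 ?subr_lt0 // divr_gt0 ?mulr_gt0 //; lra.
Qed.

Lemma affine_gt0_left p q a : 0 < p + q * a ->
  exists2 delta, 0 < delta & forall x, a - delta <= x -> x <= a -> 0 < p + q * x.
Proof.
move=> H; have q0 : 0 < `|q| + 1 by rewrite ltr_wpDl.
(* The summand 1 avoids a division by zero for constant functions. *)
exists ((p + q * a) / (`|q| + 1)); first by rewrite divr_gt0.
move=> x xl xa; have x0 : 0 <= a - x by lra.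
have : q * (a - x) <= `|q| * (a - x) by rewrite ler_wpM2r // ler_norm.
have : (a - x) * (`|q| + 1) <= p + q * a by rewrite -ler_pdivlMr //; lra.
have [xa0|xa0] := eqVneq x a; first by rewrite xa0 => *; lra.
have : 0 < a - x by rewrite lt_neqAle x0 andbT eq_sym subr_eq0 eq_sym.
lra.
Qed.

Lemma affine_gt0_between p q a b x : a <= x -> x <= b ->
  0 < p + q * a -> 0 < p + q * b -> 0 < p + q * x.
Proof.
move=> ax xb Ha Hb; have [q0|q0] := leP 0 q.
  have : 0 <= q * (x - a) by rewrite mulr_ge0 // subr_ge0.
  lra.
have : 0 <= - q * (b - x) by rewrite mulr_ge0 ?subr_ge0 // oppr_ge0 ltW.
lra.
Qed.

End Arithmetic.

(** * From decay rates to the exponents, including infinite values *)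

Lemma einv_fin (R : realType) (r : R) : r != 0 -> einv r%:E = (r^-1)%:E.
Proof. by move=> /negPf r0; rewrite /einv r0. Qed.

Lemma einv0 (R : realType) : einv (0%:E : \bar R) = +oo%E.
Proof. by rewrite /einv eqxx. Qed.

Section Exponents.
Variables (R : realType) (m n : nat) (Theta : 'M[R]_(n, m)).
Hypotheses (m_gt0 : (0 < m)%N) (n_gt0 : (0 < n)%N) (d_ge3 : (3 <= m + n)%N).

Local Notation M := (m%:R : R).
Local Notation N := (n%:R : R).
Local Notation beta := (M / N).
Local Notation D := (M + N).

Definition decays (alpha : R) :=
  beta <= alpha /\ decay_rate Theta ((alpha - beta) / (1 + alpha)).

Let M_ge1 : 1 <= M. Proof. by rewrite ler1n. Qed.
Let N_ge1 : 1 <= N. Proof. by rewrite ler1n. Qed.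
Let D_ge3 : 3 <= D. Proof. by rewrite -natrD ler_nat. Qed.
Let beta_gt0 : 0 < beta. Proof. by rewrite divr_gt0 ?ltr0n. Qed.
Let betaN : beta * N = M. Proof. by rewrite divfK // pnatr_eq0 -lt0n. Qed.
Let predD : (m + n).-1%:R = D - 1 :> R.
Proof.
have -> : D = (m + n).-1%:R + 1 by rewrite -natrD natr1 prednK //; lia.
by rewrite addrK.
Qed.

(** The forward and backward factors of [plane_decay] simplify to 1/alpha and alpha, so the value
    alpha = 1 separates the regimes. *)
Lemma psi_bounds alpha : beta <= alpha ->
  let psi := (alpha - beta) / (1 + alpha) in
  [/\ 0 <= psi, psi < 1, (1 - psi) / (beta + psi) = alpha^-1,
      (beta + psi) / (1 - psi) = alpha & psi * (1 + alpha) = alpha - beta].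
Proof.
move=> ab psi; have b0 := beta_gt0.
have a0 : 0 < alpha by exact: lt_le_trans ab.
have a1 : 0 < 1 + alpha by lra.
have E : psi * (1 + alpha) = alpha - beta by rewrite divfK // gt_eqF.
have p0 : 0 <= psi by rewrite divr_ge0 //; lra.
have p1 : psi < 1 by rewrite ltr_pdivrMr //; lra.
have E1 : alpha * (1 - psi) = beta + psi by lra.
have q0 : 0 < 1 - psi by lra.
split=> //; rewrite -E1; last by rewrite mulfK // gt_eqF.
by rewrite invfM mulrCA divff ?mulr1 // gt_eqF.
Qed.

Lemma decays_plane alpha e : decays alpha -> 0 <= e ->
  let psi := (alpha - beta) / (1 + alpha) in
  [/\ (D - 1) * e < 1, (D - 2) * e <= 2 * psi,
      (D - 2) * e <= (D - 1) * e + psi - alpha^-1 * ((D - 1) * e - psi) &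
      (D - 2) * e <= (D - 1) * e + psi - alpha * ((D - 1) * e - psi)] ->
  plane_decay_rate Theta ((D - 2) * e).
Proof.
move=> [ab dec] e0 psi [A1 A2 A3 A4]; have D3 := D_ge3.
have [p0 p1 Ef Eb Ep] := psi_bounds ab.
apply: (plane_decay m_gt0 n_gt0 d_ge3 (psi := psi) (A := (D - 1) * e)) => //.
- by rewrite mulr_ge0 //; lra.
- rewrite predD; have dn : D - 1 != 0 by rewrite gt_eqF //; lra.
  by rewrite le_eqVlt; apply/orP; left; apply/eqP; field.
- by rewrite Ef.
- by rewrite Eb.
Qed.

Lemma decays_plane_le1 alpha : decays alpha -> alpha <= 1 ->
  D * alpha - (D - 1) * beta < D - 1 ->
  plane_decay_rate Theta ((D - 2) * ((alpha - beta) / (D - 1 - alpha))).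
Proof.
move=> dec a1 H; have D3 := D_ge3; have [ab _] := dec.
have [_ _ _ _ Ep] := psi_bounds ab.
have d0 : 0 < D - 1 - alpha by lra.
have e0 : 0 <= (alpha - beta) / (D - 1 - alpha).
  by rewrite divr_ge0 ?(ltW d0) // subr_ge0.
apply: (decays_plane dec e0).
by apply: flow_bounds_le1 H Ep _ e0 => //; rewrite divfK // gt_eqF.
Qed.

Lemma decays_plane_ge1 alpha : decays alpha -> 1 <= alpha -> 1 < (D - 1) * beta ->
  plane_decay_rate Theta ((D - 2) * ((alpha - beta) / ((D - 1) * alpha - 1))).
Proof.
move=> dec a1 H; have D3 := D_ge3; have [ab _] := dec.
have [_ _ _ _ Ep] := psi_bounds ab.
have k1 : 0 <= (D - 2) * (alpha - 1) by rewrite mulr_ge0; lra.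
have d0 : 0 < (D - 1) * alpha - 1 by lra.
have e0 : 0 <= (alpha - beta) / ((D - 1) * alpha - 1).
  by rewrite divr_ge0 ?(ltW d0) // subr_ge0.
apply: (decays_plane dec e0).
by apply: flow_bounds_ge1 H Ep _ e0 => //; rewrite divfK // gt_eqF.
Qed.

Lemma decays_solvable2 (alpha gamma : R) : (2 <= m)%N -> decays alpha -> -1 < gamma ->
  (alpha <= 1 -> (1 + gamma) * (D - 2 + N * (1 - alpha)) < D - 2 + (1 - alpha)) ->
  (1 <= alpha -> (1 + gamma) * (N * alpha + M - 2) < (D - 1) * alpha - 1) ->
  uniform_solvable Theta 2 gamma.
Proof.
move=> m2 dec g1 L1 L2; have [ab _] := dec.
have M2 : 2 <= M by rewrite ler_nat.
have D3 := D_ge3; have N1 := N_ge1; have b0 := beta_gt0.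
have wE : plane_weight R m n = 2 by rewrite /plane_weight; case: eqP => // m1; lia.
(* Indeed (D - 1) beta = m + (m - 1) beta. Both regimes rely on this. *)
have Db : 1 < (D - 1) * beta.
  have : 0 <= M * beta by rewrite mulr_ge0 // ltW.
  have := betaN; have : 0 <= (M - 2) * beta by rewrite mulr_ge0 ?(ltW b0) // subr_ge0.
  lra.
have [a1|a1] := leP alpha 1.
  have H : D * alpha - (D - 1) * beta < D - 1.
    have : D * alpha <= D * 1 by rewrite ler_wpM2l //; lra.
    lra.
  apply: (plane_decay_uniform_solvable2 m_gt0 n_gt0 g1 _ (decays_plane_le1 dec a1 H)).
  rewrite wE; apply: solvable_cond_le1 => //; first by lra.
  exact: L1.
have k1 : 0 <= (D - 2) * (alpha - 1) by rewrite mulr_ge0; lra.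
apply: (plane_decay_uniform_solvable2 m_gt0 n_gt0 g1 _ (decays_plane_ge1 dec (ltW a1) Db)).
rewrite wE; apply: solvable_cond_ge1 => //; first by lra.
by apply: L2; apply: ltW.
Qed.

Lemma decays_solvable2_dim1 (alpha gamma : R) : m = 1%N -> decays alpha ->
  alpha < 1 -> -1 < gamma ->
  (1 + gamma) * (N - 1) * (1 - alpha) < N - alpha ->
  uniform_solvable Theta 2 gamma.
Proof.
move=> m1 dec a1 g1 L; have [ab _] := dec.
have MR : M = 1 by rewrite m1.
have D3 := D_ge3; have b0 := beta_gt0; have bN := betaN.
(* For m = 1 the product (D - 1) beta equals 1, so strictness has to come from alpha < 1. *)
have H : D * alpha - (D - 1) * beta < D - 1.
  have : D * alpha < D * 1 by rewrite ltr_pM2l //; lra.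
  rewrite MR in D3 bN *; lra.
apply: (plane_decay_uniform_solvable2 m_gt0 n_gt0 g1 _ (decays_plane_le1 dec (ltW a1) H)).
have -> : plane_weight R m n = 1 - 1 / N by rewrite /plane_weight MR; case: eqP.
rewrite MR; apply: solvable_cond_dim1 => //.
rewrite MR in D3; lra.
Qed.

(** The Dirichlet bound, of rate 0. It serves whenever the first exponent does not exceed beta. *)
Lemma decays_beta : decays beta.
Proof.
by split=> //; rewrite subrr mul0r; apply: decay_rate0.
Qed.

Lemma decays_lt alpha : beta <= alpha -> (alpha%:E < uniform_exponent Theta 1)%E ->
  decays alpha.
Proof.
move=> ab /ereal_sup_gt[_ [a' sa' <-]]; rewrite lte_fin => aa'; split=> //.
have b0 := beta_gt0.
have [a1 a1'] : 0 < 1 + alpha /\ 0 < 1 + a' by lra.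
apply: (decay_rate_le _ (uniform_solvable1_decay m_gt0 n_gt0 _ sa')); last by lra.
rewrite ler_pdivrMr // mulrAC ler_pdivlMr //.
have : 0 <= (a' - alpha) * (1 + beta) by rewrite mulr_ge0 //; lra.
lra.
Qed.

(** The supremum need not be attained, so a slightly smaller [r] replaces it, close enough to
    preserve a strict affine inequality. *)
Lemma decays_near a l p q : beta <= a -> (a%:E <= uniform_exponent Theta 1)%E ->
  beta < a -> l < a -> 0 < p + q * a ->
  exists r, [/\ l <= r, r < a, decays r & 0 < p + q * r].
Proof.
move=> ba aS ba' la /affine_gt0_left[delta d0 H].
pose r := Num.max (Num.max l beta) (a - delta).
have ra : r < a by rewrite !gt_max la ba' ltrBlDr ltrDl.
exists r; split=> //.
- by rewrite !le_max lexx.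
- apply: decays_lt; first by rewrite !le_max lexx orbT.
  by apply: lt_le_trans aS; rewrite lte_fin.
- by apply: H; rewrite ?(ltW ra) // !le_max lexx orbT.
Qed.

Lemma le_uniform_exponent (T : \bar R) p : ((-1)%:E < T)%E ->
  (forall gamma : R, -1 < gamma -> (gamma%:E < T)%E -> uniform_solvable Theta p gamma) ->
  (T <= uniform_exponent Theta p)%E.
Proof.
move=> T1 H; rewrite leNgt; apply/negP => supT.
have [g [g1 gT gsup]] : exists g, [/\ -1 < g, (g%:E < T)%E &
    (uniform_exponent Theta p < g%:E)%E].
  (* The value [g] is chosen strictly between max(supremum, -1) and [T], according to which of these
     are infinite. *)
  move: T1 supT; case: (uniform_exponent Theta p) => [u| |]; case: T {H} => [t| |] //=;
    rewrite ?lte_fin => T1 supT; rewrite ?ltry.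
  - exists ((Num.max u (-1) + t) / 2).
    have : Num.max u (-1) < t by rewrite gt_max supT T1.
    have : u <= Num.max u (-1) by rewrite le_max lexx.
    have : -1 <= Num.max u (-1) by rewrite le_max lexx orbT.
    by move=> *; split; rewrite ?lte_fin; lra.
  - exists (Num.max u (-1) + 1).
    have : u <= Num.max u (-1) by rewrite le_max lexx.
    have : -1 <= Num.max u (-1) by rewrite le_max lexx orbT.
    by move=> *; split; rewrite ?lte_fin ?ltry //; lra.
  - exists ((-1 + t) / 2); split; rewrite ?lte_fin ?ltNyr //; lra.
  - exists 0; split; rewrite ?ltry ?ltNyr //; lra.
have : (g%:E <= uniform_exponent Theta p)%E.
  by apply: ereal_sup_ubound; exists g => //; apply: H.
by rewrite leNgt gsup.
Qed.

Lemma exponent2_dim1 : m = 1%N ->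
  (einv (1 - uniform_exponent Theta 1) - ((N - 2) / (N - 1))%:E
   <= uniform_exponent Theta 2)%E.
Proof.
move=> m1; have MR : M = 1 by rewrite m1.
have N2 : 2 <= N by have := D_ge3; rewrite MR; lra.
have b0 := beta_gt0; have bN := betaN.
have b1 : beta < 1 by rewrite ltr_pdivrMr ?ltr0n // MR; lra.
have q0 : 0 < N - 1 by lra.
have solv (a gamma : R) : beta < a -> a <= 1 -> (a%:E <= uniform_exponent Theta 1)%E ->
    -1 < gamma -> (1 + gamma) * (N - 1) * (1 - a) < N - a ->
    uniform_solvable Theta 2 gamma.
  move=> ba a1 aS g1 L.
  have [|r [_ ra dr Lr]] := @decays_near a 0 (N - (1 + gamma) * (N - 1))
    ((1 + gamma) * (N - 1) - 1) (ltW ba) aS ba (lt_trans b0 ba); first by lra.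
  apply: (decays_solvable2_dim1 m1 dr) => //; first exact: lt_le_trans a1.
  lra.
have [a1S|Sa1] := leP 1%E (uniform_exponent Theta 1).
  (* At a = 1 the condition on gamma reads 0 < N - 1, so every gamma > -1 is admissible and the
     second exponent is infinite. *)
  apply: (@le_trans _ _ +oo%E); first exact: leey.
  apply: le_uniform_exponent => [|g g1 _]; first exact: ltry.
  by apply: (solv 1) => //; rewrite subrr mulr0; lra.
have Lbeta (gamma : R) : -1 < gamma -> (forall a, (a%:E = uniform_exponent Theta 1)%E ->
      (1 + gamma) * (N - 1) * (1 - a) < N - a) ->
    ((uniform_exponent Theta 1 = -oo)%E -> (1 + gamma) * (N - 1) < 1) ->
    uniform_solvable Theta 2 gamma.
  move=> g1 La Loo.
  have dim1 : (1 + gamma) * (N - 1) * (1 - beta) < N - beta ->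
      uniform_solvable Theta 2 gamma.
    by move=> L; apply: (decays_solvable2_dim1 m1 decays_beta).
  case E : (uniform_exponent Theta 1) Sa1 => [a| |] // Sa1; last first.
    apply: dim1; have : (1 + gamma) * (N - 1) * (1 - beta) <= 1 * (1 - beta).
      by rewrite ler_wpM2r ?subr_ge0 ?(ltW b1) // ltW // Loo.
    lra.
  have L := La a (esym E); rewrite lte_fin in Sa1.
  have [ba|ab] := ltP beta a.
    by apply: (solv a) => //; [exact: ltW | rewrite E].
  apply: dim1.
  (* Since a <= beta <= 1, the condition at beta follows from those at a and at 1, where it reads N
     - 1 > 0. *)
  have := @affine_gt0_between _ (N - (1 + gamma) * (N - 1))
    ((1 + gamma) * (N - 1) - 1) a 1 beta ab (ltW b1).
  lra.
have Sy : (uniform_exponent Theta 1 < +oo)%E by apply: lt_trans Sa1 (ltry _).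
have e1 : (N - 2) / (N - 1) = 1 - (N - 1)^-1 by field; rewrite gt_eqF.
have q1 : 0 < (N - 1)^-1 by rewrite invr_gt0.
rewrite e1; case E : (uniform_exponent Theta 1) Sa1 Sy => [a| |] // Sa1 _.
  rewrite lte_fin in Sa1; have a0 : 0 < 1 - a by lra.
  rewrite -EFinB /= gt_eqF // -EFinB.
  have a2 : 0 < (1 - a)^-1 by rewrite invr_gt0.
  apply: le_uniform_exponent => [|g g1]; first by rewrite lte_fin; lra.
  rewrite lte_fin => gT; apply: Lbeta => // [a'|]; rewrite E // => -[->].
  have : (1 + g) * ((N - 1) * (1 - a)) < ((1 - a)^-1 + (N - 1)^-1) * ((N - 1) * (1 - a)).
    by rewrite ltr_pM2r ?mulr_gt0 //; lra.
  have -> : ((1 - a)^-1 + (N - 1)^-1) * ((N - 1) * (1 - a)) = N - 1 + (1 - a).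
    by field; rewrite !gt_eqF.
  lra.
have -> : (einv (1 - -oo) = 0 :> \bar R)%E by [].
rewrite sub0e -EFinN.
apply: le_uniform_exponent => [|g g1]; first by rewrite lte_fin; lra.
rewrite lte_fin => gT; apply: Lbeta => // [a'|_]; first by rewrite E.
have : 1 + g < (N - 1)^-1 by lra.
by rewrite -(ltr_pM2r q0) mulVf // gt_eqF.
Qed.

Lemma exponent2_le1 : (2 <= m)%N -> (uniform_exponent Theta 1 <= 1)%E ->
  ((N - 1)%:E * einv ((- N)%:E - (D - 2)%:E * einv (1 - uniform_exponent Theta 1))
   <= uniform_exponent Theta 2)%E.
Proof.
move=> m2 S1; have M2 : 2 <= M by rewrite ler_nat.
have Sfin a : uniform_exponent Theta 1 = a%:E -> a <= 1.
  by move=> E; move: S1; rewrite E lee_fin.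
have Sy : uniform_exponent Theta 1 <> +oo%E by move=> E; move: S1; rewrite E.
clear S1; have D3 := D_ge3; have N1 := N_ge1; have b0 := beta_gt0.
have solv (gamma : R) : -1 < gamma -> gamma < 0 ->
    (forall a, (a%:E = uniform_exponent Theta 1)%E ->
      (1 + gamma) * (D - 2 + N * (1 - a)) < D - 2 + (1 - a)) ->
    ((uniform_exponent Theta 1 = -oo)%E -> (1 + gamma) * N < 1) ->
    uniform_solvable Theta 2 gamma.
  move=> g1 g0 La Loo.
  have k : 0 < (D - 2) * - gamma by rewrite mulr_gt0; lra.
  have dimb : (beta <= 1 -> (1 + gamma) * (D - 2 + N * (1 - beta)) < D - 2 + (1 - beta)) ->
      uniform_solvable Theta 2 gamma.
    move=> L; apply: (decays_solvable2 m2 decays_beta g1 L) => b1.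
    have : (1 + gamma) * N <= 1 * N by rewrite ler_wpM2r; lra.
    move=> gN; have : 0 <= (D - 1 - (1 + gamma) * N) * (beta - 1).
      by rewrite mulr_ge0 ?subr_ge0 //; lra.
    lra.
  case E : (uniform_exponent Theta 1) => [a| |] //; last first.
    apply: dimb => b1; have : 0 <= (1 - (1 + gamma) * N) * (1 - beta).
      by rewrite mulr_ge0 // subr_ge0 // ltW // Loo.
    lra.
  have L := La a (esym E); have S1 := Sfin a E.
  have [ba|ab] := ltP beta a.
    have [||r [_ ra dr Lr]] := @decays_near a 0 (D - 1 - (1 + gamma) * (D - 2 + N))
      ((1 + gamma) * N - 1) (ltW ba) _ ba (lt_trans b0 ba); [by rewrite E | lra |].
    have r1 := lt_le_trans ra S1.
    by apply: (decays_solvable2 m2 dr) => // H; lra.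
  apply: dimb => b1.
  have := @affine_gt0_between _ (D - 1 - (1 + gamma) * (D - 2 + N))
    ((1 + gamma) * N - 1) a 1 beta ab b1.
  lra.
case E : (uniform_exponent Theta 1) => [a| |] //.
- have S1 := Sfin a E; rewrite -EFinB.
  have [a1|a1] := eqVneq a 1.
    (* At a = 1 the inner inverse is +oo, the outer one is 0, and the bound to prove is 0. *)
    rewrite a1 subrr einv0 gt0_muley ?lte_fin; last by lra.
    rewrite addeNy /= mule0.
    apply: le_uniform_exponent => [|g g1]; first by rewrite lte_fin ltrN10.
    rewrite lte_fin => g0; apply: solv => // [a'|]; rewrite E // => -[->]; rewrite a1.
    have : 0 < (D - 2) * - g by rewrite mulr_gt0; lra.
    lra.
  have a0 : 0 < 1 - a by rewrite subr_gt0 lt_neqAle a1.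
  rewrite einv_fin ?gt_eqF // -EFinM -EFinB.
  have den : 0 < N * (1 - a) + (D - 2) by rewrite addr_gt0 ?mulr_gt0 //; lra.
  have innerE : - N - (D - 2) / (1 - a) = - ((N * (1 - a) + (D - 2)) / (1 - a)).
    by field; rewrite gt_eqF.
  rewrite innerE einv_fin ?oppr_eq0 ?gt_eqF ?divr_gt0 // -EFinM invrN invf_div.
  set T := (N - 1) * _.
  have TE : T * (N * (1 - a) + (D - 2)) = - ((N - 1) * (1 - a)).
    by rewrite /T; field; rewrite gt_eqF.
  have T1 : -1 < T by rewrite -(ltr_pM2r den) TE; lra.
  have T0 : T <= 0.
    rewrite -(ler_pM2r den) TE mul0r oppr_le0 mulr_ge0 ?(ltW a0) //; lra.
  apply: le_uniform_exponent => [|g g1]; first by rewrite lte_fin.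
  rewrite lte_fin => gT; apply: solv => // [|a'|]; rewrite ?E //; first by lra.
  move=> [->]; have : g * (N * (1 - a) + (D - 2)) < - ((N - 1) * (1 - a)).
    by rewrite -TE ltr_pM2r.
  lra.
- have -> : (einv (1 - -oo) = 0 :> \bar R)%E by [].
  rewrite mule0 sube0 einv_fin; last by rewrite oppr_eq0 gt_eqF; lra.
  rewrite -EFinM invrN; set T := (N - 1) * _.
  have N0 : 0 < N by lra.
  have TE : T * N = - (N - 1) by rewrite /T; field; rewrite gt_eqF.
  apply: le_uniform_exponent => [|g g1]; first by rewrite lte_fin -(ltr_pM2r N0) TE; lra.
  rewrite lte_fin => gT; have gN : g * N < - (N - 1) by rewrite -TE ltr_pM2r.
  apply: solv => // [|a'|_]; rewrite ?E //; last by lra.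
  by rewrite -(ltr_pM2r N0); lra.
Qed.

Lemma exponent2_ge1 : (2 <= m)%N -> (1 <= uniform_exponent Theta 1)%E ->
  ((M - 1)%:E * einv (N%:E + (D - 2)%:E * einv (uniform_exponent Theta 1 - 1))
   <= uniform_exponent Theta 2)%E.
Proof.
move=> m2 S1; have M2 : 2 <= M by rewrite ler_nat.
have D3 := D_ge3; have N1 := N_ge1; have b0 := beta_gt0.
case E : (uniform_exponent Theta 1) S1 => [a| |] // S1; last first.
  have -> : (einv (+oo - 1) = 0 :> \bar R)%E by [].
  rewrite mule0 adde0 einv_fin; last by rewrite gt_eqF; lra.
  clear S1.
  have N0 : 0 < N by lra.
  rewrite -EFinM.
  have T0 : 0 <= (M - 1) / N by rewrite divr_ge0; lra.
  apply: le_uniform_exponent => [|g g1]; first by rewrite lte_fin; lra.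
  rewrite lte_fin ltr_pdivlMr // => gN.
  pose q := M - 1 - g * N; have q0 : 0 < q by rewrite /q; lra.
  (* With an infinite first exponent any [r] is allowed; this one satisfies q (r - 1) > (D - 2) |g|,
     which implies the required condition. *)
  pose r := 1 + beta + (D - 2) * `|g| / q + 1.
  have k : 0 <= (D - 2) * `|g| / q by rewrite divr_ge0 ?(ltW q0) // mulr_ge0 //; lra.
  have dr : decays r.
    by apply: decays_lt; [rewrite /r; lra | rewrite E ltry].
  apply: (decays_solvable2 m2 dr) => // r1; first by rewrite /r in r1; lra.
  have qr : q * ((D - 2) * `|g| / q) = (D - 2) * `|g| by rewrite mulrC divfK // gt_eqF.
  have : 0 < q * (1 + beta) by rewrite mulr_gt0 //; lra.
  have : (D - 2) * g <= (D - 2) * `|g| by rewrite ler_wpM2l ?ler_norm //; lra.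
  have : q * (r - 1) = q * (1 + beta) + (D - 2) * `|g| by rewrite -qr /r; ring.
  rewrite /q; lra.
rewrite lee_fin in S1; rewrite -EFinB.
have [a1|a1] := eqVneq a 1.
  rewrite a1 subrr einv0 gt0_muley ?lte_fin; last by lra.
  rewrite addey // /= mule0.
  apply: le_uniform_exponent => [|g g1]; first by rewrite lte_fin ltrN10.
  rewrite lte_fin => g0.
  have k : 0 < (D - 2) * - g by rewrite mulr_gt0; lra.
  (* If beta < 1, the value 1 is approached from below, inside the regime alpha <= 1; otherwise the
     Dirichlet rate suffices. *)
  have [b1|b1] := ltP beta 1.
    have [||r [_ r1 dr Lr]] := @decays_near 1 0 (D - 1 - (1 + g) * (D - 2 + N))
      ((1 + g) * N - 1) (ltW b1) _ b1 ltr01; [by rewrite E a1 | lra |].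
    by apply: (decays_solvable2 m2 dr) => // H; lra.
  apply: (decays_solvable2 m2 decays_beta) => // H.
    have -> : beta = 1 by apply/eqP; rewrite eq_le H b1.
    lra.
  have : (1 + g) * N <= 1 * N by rewrite ler_wpM2r; lra.
  move=> gN; have : 0 <= (D - 1 - (1 + g) * N) * (beta - 1).
    by rewrite mulr_ge0 ?subr_ge0 //; lra.
  lra.
have a0 : 0 < a - 1 by rewrite subr_gt0 lt_neqAle eq_sym a1.
rewrite einv_fin ?gt_eqF // -EFinM -EFinD.
have den : 0 < N * (a - 1) + (D - 2) by rewrite addr_gt0 ?mulr_gt0 //; lra.
have innerE : N + (D - 2) / (a - 1) = (N * (a - 1) + (D - 2)) / (a - 1).
  by field; rewrite gt_eqF.
rewrite innerE einv_fin ?gt_eqF ?divr_gt0 // -EFinM invf_div.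
set T := (M - 1) * _.
have TE : T * (N * (a - 1) + (D - 2)) = (M - 1) * (a - 1).
  by rewrite /T; field; rewrite gt_eqF.
have T0 : 0 <= T by rewrite -(ler_pM2r den) TE mul0r mulr_ge0 ?(ltW a0) //; lra.
apply: le_uniform_exponent => [|g g1]; first by rewrite lte_fin; lra.
rewrite lte_fin => gT.
have L : g * (N * (a - 1) + (D - 2)) < (M - 1) * (a - 1) by rewrite -TE ltr_pM2r.
have [ba|ab] := ltP beta a.
  (* The lower limit (1 + a)/2 keeps [r] above 1, in the regime alpha >= 1. *)
  have [|||r [lr ra dr Lr]] := @decays_near a ((1 + a) / 2) (- 1 - (1 + g) * (M - 2))
    (D - 1 - (1 + g) * N) (ltW ba) _ ba; [by rewrite E | lra | lra |].
  by apply: (decays_solvable2 m2 dr) => // H; lra.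
apply: (decays_solvable2 m2 decays_beta) => // H; first by lra.
(* The condition is affine in alpha with this slope, so it carries over from a to the larger value
   beta. *)
have gN : 0 <= M - 1 - g * N.
  have TN : T * N <= M - 1.
    have TD : 0 <= T * (D - 2) by rewrite mulr_ge0 //; lra.
    rewrite -(ler_pM2r a0) -TE; lra.
  have : g * N <= T * N by rewrite ler_wpM2r ?(ltW gT) //; lra.
  lra.
have : 0 <= (M - 1 - g * N) * (beta - a) by rewrite mulr_ge0 // subr_ge0.
lra.
Qed.

End Exponents.

Theorem theorem3 (R : realType) (m n : nat) (Theta : 'M[R]_(n, m))
    (m_ge1 : (1 <= m)%N) (n_ge1 : (1 <= n)%N) (d_ge3 : (3 <= m + n)%N) :
  let a1 := uniform_exponent Theta 1 in
  let a2 := uniform_exponent Theta 2 in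
  let d := (m + n)%N in
  [/\ m = 1%N ->
        (einv (1 - a1) - ((n%:R - 2) / (n%:R - 1))%R%:E <= a2)%E,
      (2 <= m)%N -> (a1 <= 1)%E ->
        ((n%:R - 1)%R%:E
           * einv ((- n%:R)%R%:E - (d%:R - 2)%R%:E * einv (1 - a1)) <= a2)%E
    & (2 <= m)%N -> (1 <= a1)%E ->
        ((m%:R - 1)%R%:E
           * einv (n%:R%:E + (d%:R - 2)%R%:E * einv (a1 - 1)) <= a2)%E].
Proof.
move=> a1 a2 d; rewrite /d natrD; split; [exact: exponent2_dim1|exact: exponent2_le1|].
exact: exponent2_ge1.
Qed.
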